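(* Suppose that $\nabla\mathbb V$ is Lipschitz, and let $\hat X\in E$. For $\Delta t,\rho>0$ and $c\ge0$ put $c_1:=\rho(\Delta t)^2(1+c(\Delta t)^2)$, $c_2:=\rho(\Delta t)^3(1+c(\Delta t)^2)$, $c_3:=c\rho(\Delta t)^3$, $T:=I-c_2\mathbb B\mathbb B^*$. For a potential $\hat{\mathbb V}$ specified below consider the iteration $X^0=X_0$, $V^0=V_0$ and, for $l\in\mathbb N_0$, $$X^{l+1}=X^l+\Delta t\,V^{l+1},\qquad V^{l+1}=V^l-\Delta t\,T\bigl(\Psi(X^l)+c_1T^{-1/2}\mathbb B\mathbb B^*T^{-1/2}\bigr)V^l-\Delta t\,T\bigl(\nabla\mathbb V(X^l)+\nabla\hat{\mathbb V}(X^l)\bigr),$$ with arbitrary $X_0,V_0\in E$. Let $H_{\mathrm{cl}}(X,V)=\frac12\langle V,T^{-1}V\rangle+\mathbb V(X)+\hat{\mathbb V}(X)$ and, for $\varepsilon>0$, define $$H_{\mathrm{cl},\varepsilon}(X,V)=H_{\mathrm{cl}}(X,V)+\varepsilon\langle V,T(\nabla\mathbb V(X)+\nabla\hat{\mathbb V}(X))\rangle.$$ (i) Suppose there exist $\underline\psi>0$ and a closed subspace $E_0\subseteq\operatorname{ran}(\mathbb B)$ such that $\langle W,\Psi(X)W\rangle\ge\underline\psi\|(I-P_{E_0})W\|^2$ for all $W,X\in E$, where $P_{E_0}$ is the orthogonal projection onto $E_0$. Let $\hat{\mathbb V}(X)=\frac{c_3}{2}\|\mathbb B^*T^{-1/2}(X-\hat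 X)\|^2$. Then there exists a constant $0<\alpha<1$ (which can be chosen as $\alpha=1/66$) such that for every $\gamma\in(0,1]$ and all $\overline c\ge0$ there exists $h>0$ (depending on $\overline c,\gamma,\underline\psi,\|\Psi\|_\infty$, a Lipschitz constant of $\nabla\mathbb V$, the constant $C$ from the context, and $\mathbb B$) such that if $$0\le c\le\overline c,\qquad\frac{\gamma\alpha}{(\Delta t)^3(1+c(\Delta t)^2)\|\mathbb B\mathbb B^*\|}\le\rho\le\frac{\alpha}{(\Delta t)^3(1+c(\Delta t)^2)\|\mathbb B\mathbb B^*\|},\qquad0<\Delta t\le h,$$ then $H_{\mathrm{cl},3\Delta t}$ is bounded from below and for all $l\in\mathbb N_0$ $$H_{\mathrm{cl},3\Delta t}(X^{l+1},V^{l+1})\le H_{\mathrm{cl},3\Delta t}(X^l,V^l)-\tfrac{\Delta t}{2}\underline\psi\|(I-P_{E_0})V^l\|^2-\tfrac{c_1\Delta t}{4}\|\mathbb B^*T^{-1/2}V^l\|^2-\tfrac{(\Delta t)^2}{2}\bigl\|T(\nabla\mathbb V(X^l)+\nabla\hat{\mathbb V}(X^l))\bigr\|^2.$$ (ii) Suppose that $\mathbb B$ is surjective and let $\hat{\mathbb V}(X)=\frac{c_3}{2}\|\mathbb B^*T^{-1/2}(X-\hat X)\|^2-\langle\nabla\mathbb V(\hat X),X-\hat X\rangle$. Then there exist a constant $0<\alpha<1$ (which can be chosen as $\alpha=1/66$) and a constant $\nu>0$ (only depending on $\mathbb B$) such that for every $\gamma\in(0,1]$ and all $\overline c>0$ there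 exists $h>0$ (depending on $\overline c,\gamma,\|\Psi\|_\infty,\|\nabla\mathbb V(\hat X)\|$, a Lipschitz constant of $\nabla\mathbb V$, the constant $C$ from the context, and $\mathbb B$) such that if $$0<c\le\overline c,\qquad\frac{\gamma\alpha}{(\Delta t)^3(1+c(\Delta t)^2)\|\mathbb B\mathbb B^*\|}\le\rho\le\frac{\alpha}{(\Delta t)^3(1+c(\Delta t)^2)\|\mathbb B\mathbb B^*\|},\qquad0<\Delta t\le h,$$ then $H_{\mathrm{cl},3\Delta t}$ is bounded from below and for all $l\in\mathbb N_0$ $$H_{\mathrm{cl},3\Delta t}(X^{l+1},V^{l+1})\le H_{\mathrm{cl},3\Delta t}(X^l,V^l)-\nu c_1\Delta t\|V^l\|^2-\tfrac{(\Delta t)^2}{2}\bigl\|T(\nabla\mathbb V(X^l)+\nabla\hat{\mathbb V}(X^l))\bigr\|^2.$$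
   Context: Standing assumptions. $E,U$ are real Hilbert spaces with norms $\|\cdot\|$ and inner products $\langle\cdot,\cdot\rangle$; gradients are Riesz gradients. $\mathbb V\in C^1(E;\mathbb R)$ is bounded from below by $\underline{\mathcal V}\in\mathbb R$ and there is $C>0$ with $\|\nabla\mathbb V(X)\|^2\le C(1+\mathbb V(X)-\underline{\mathcal V})$ for all $X\in E$. $\Psi:E\to\mathscr L(E)$ is bounded, $\|\Psi\|_\infty:=\sup_{X\in E}\|\Psi(X)\|<\infty$, and $\Psi(X)$ is self-adjoint and positive semidefinite for every $X\in E$. $\mathbb B\in\mathscr L(U;E)$ has closed range; $\mathbb B^*$ is its adjoint. The bounds on $\rho$ ensure $c_2\|\mathbb B\mathbb B^*\|\le\alpha<1$, so that $T$ is self-adjoint, positive definite and boundedly invertible. The iteration is the semi-explicit Euler discretization with step size $\Delta t$ of $\frac{d}{dt}X_t=V_t$, $\frac{d}{dt}V_t=-c_1\mathbb B\mathbb B^*V_t-T(\Psi(X_t)V_t+\nabla\mathbb V(X_t)+\nabla\hat{\mathbb V}(X_t))$. *)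

(* Defs.v *)
From HB Require Import structures.
From mathcomp Require Import all_boot all_order all_algebra.
From mathcomp Require Import all_classical all_reals all_analysis.

Set Implicit Arguments.
Unset Strict Implicit.
Unset Printing Implicit Defensive.

Import Order.TTheory GRing.Theory Num.Theory.
Import numFieldNormedType.Exports.

Local Open Scope classical_set_scope.
Local Open Scope ring_scope.

HB.mixin Record isHilbert (R : realType) E of CompleteNormedModule R E := {
  inner : {dot E for idfun} ;
  inner_norm : forall x : E, inner x x = `|x| ^+ 2
}.

#[short(type="hilbertType")]
HB.structure Definition Hilbert (R : realType) :=
  { E of CompleteNormedModule R E & isHilbert R E }.

(* Adjoints, orthogonal projections, gradients and square roots are total
   functions: the unique object with the defining property where it exists,
   and the default value 0 elsewhere. *)

Definition opnorm (R : realType) (E F : normedModType R) (f : E -> F) : R :=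
  sup [set `|f x| | x in [set x : E | `|x| <= 1]].

Definition adjoint (R : realType) (E F : hilbertType R) (f : E -> F) : F -> E :=
  fun y => xget 0 [set z | forall x, inner (f x) y = inner x z].

Definition orth_proj (R : realType) (E : hilbertType R) (S : set E) : E -> E :=
  fun x => xget 0 [set p | S p /\ forall w, S w -> inner (x - p) w = 0].

Definition closed_subspace (R : realType) (E : normedModType R) (S : set E) :=
  [/\ closed S, S 0 & forall (a : R) x y, S x -> S y -> S (a *: x + y)].

Definition grad (R : realType) (E : hilbertType R) (V : E -> R) : E -> E :=
  fun x => xget 0 [set g | forall h, 'd V x h = inner g h].

Definition C1 (R : realType) (E : normedModType R) (V : E -> R) :=
  (forall x, differentiable V x) /\
  (forall x, opnorm (fun h => 'd V y h - 'd V x h) @[y --> x] --> (0 : R)).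

Definition self_adjoint (R : realType) (E : hilbertType R) (f : E -> E) :=
  forall x y, inner (f x) y = inner x (f y).

Definition psd (R : realType) (E : hilbertType R) (f : E -> E) :=
  forall x, 0 <= inner x (f x).

Definition opinv (R : realType) (E : normedModType R) (f : E -> E) : E -> E :=
  'pinv_(fun=> 0) setT f.

Definition opsqrt (R : realType) (E : hilbertType R) (f : E -> E) : E -> E :=
  xget (fun=> 0) [set S : E -> E |
    [/\ linear S, continuous S, self_adjoint S, psd S & S \o S = f]].

Definition admissible_potential (R : realType) (E : hilbertType R)
    (C Vmin : R) (V : E -> R) :=
  [/\ C1 V, (forall X, Vmin <= V X) &
      forall X, `|grad V X| ^+ 2 <= C * (1 + V X - Vmin)].

(* The operators Psi X are uniformly bounded, so that supnorm Psi is an actual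
   supremum. *)
Definition admissible_friction (R : realType) (E : hilbertType R)
    (Psi : E -> {linear E -> E}) :=
  [/\ forall X, continuous (Psi X),
      has_ubound (range (fun X => opnorm (Psi X))),
      forall X, self_adjoint (Psi X) & forall X, psd (Psi X)].

Definition supnorm (R : realType) (E : hilbertType R)
    (Psi : E -> {linear E -> E}) : R :=
  sup (range (fun X => opnorm (Psi X))).

Definition c1 (R : realType) (dt rho c : R) : R :=
  rho * dt ^+ 2 * (1 + c * dt ^+ 2).

Definition c2 (R : realType) (dt rho c : R) : R :=
  rho * dt ^+ 3 * (1 + c * dt ^+ 2).

Definition c3 (R : realType) (dt rho c : R) : R := c * rho * dt ^+ 3.

Section Scheme.
Context (R : realType) (E U : hilbertType R) (B : U -> E).
Variables dt rho c : R.

Definition BBs : E -> E := B \o adjoint B.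

Definition Top : E -> E := fun x => x - c2 dt rho c *: BBs x.

Definition Tinvsqrt : E -> E := opsqrt (opinv Top).

Definition Vhat_quad (Xhat : E) : E -> R := fun X =>
  c3 dt rho c / 2 * `|adjoint B (Tinvsqrt (X - Xhat))| ^+ 2.

Definition Vhat_lin (V : E -> R) (Xhat : E) : E -> R := fun X =>
  Vhat_quad Xhat X - inner (grad V Xhat) (X - Xhat).

Definition Hcl (V Vhat : E -> R) (X W : E) : R :=
  2^-1 * inner W (opinv Top W) + V X + Vhat X.

Definition Hcl_eps (V Vhat : E -> R) (eps : R) (X W : E) : R :=
  Hcl V Vhat X W + eps * inner W (Top (grad V X + grad Vhat X)).

Definition euler_scheme (V Vhat : E -> R) (Psi : E -> {linear E -> E})
    (X0 V0 : E) (Xs Vs : nat -> E) :=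
  [/\ Xs 0%N = X0, Vs 0%N = V0,
      forall l, Xs l.+1 = Xs l + dt *: Vs l.+1 &
      forall l, Vs l.+1 = Vs l
        - dt *: Top (Psi (Xs l) (Vs l)
                     + c1 dt rho c *: Tinvsqrt (BBs (Tinvsqrt (Vs l))))
        - dt *: Top (grad V (Xs l) + grad Vhat (Xs l))].

(* For B = 0 the quotients are 0 and, as 0 < rho, the condition fails. *)
Definition step_condition (alpha gamma h : R) :=
  [/\ 0 < rho,
      gamma * alpha / (dt ^+ 3 * (1 + c * dt ^+ 2) * opnorm BBs) <= rho,
      rho <= alpha / (dt ^+ 3 * (1 + c * dt ^+ 2) * opnorm BBs) &
      0 < dt <= h].

End Scheme.

(* Main.v *)
(* Put A = B B^*, D = A T^-1 = T^(-1/2) A T^(-1/2) and G = grad V + grad Vhat.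
   Since T D = A and c2 = dt c1, the scheme reads V' = T (V - dt Psi V - dt G),
   i.e. T^-1 V' = V - dt Psi V - dt G, and the kinetic plus linearised potential
   energy changes by
     <V, T V> / 2 - <V, T^-1 V> / 2 - dt <Psi V, T V> + O(dt^2).
   Here <V, T V> - <V, T^-1 V> <= - c2 <V, D V>, where c2 is bounded away from 0
   by the lower bound on rho, and the term dt <Psi V, T V> produces the friction.
   The cross term 3 dt <V, T G> adds - 3 dt^2 |T G|^2; its only critical
   contribution 3 dt c2 <A V, T G> is absorbed by AM-GM because c2 |A| <= 1/66.
   What remains is O(dt^2) |V|^2, which for small dt is absorbed because
   |V|^2 <= k1 <V, Psi V> + k2 <V, D V>: B^* is bounded below on ran B, by
   uniform boundedness. *)
Require Import Defs.
From HB Require Import structures.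
From mathcomp Require Import all_boot all_order all_algebra.
From mathcomp Require Import all_classical all_reals all_analysis.
From mathcomp Require Import ring lra.

Set Implicit Arguments.
Unset Strict Implicit.
Unset Printing Implicit Defensive.

Import Order.TTheory GRing.Theory Num.Theory.
Import numFieldNormedType.Exports.

Local Open Scope classical_set_scope.
Local Open Scope ring_scope.

(** * Hilbert spaces and bounded operators *)

Section InnerProduct.
Context (R : realType) (E : hilbertType R).
Implicit Types x y z : E.

Lemma innerC x y : inner x y = inner y x.
Proof. by have := hermC (inner : {dot E for idfun}) x y; rewrite expr0 mul1r. Qed.

Lemma innerDl x y z : inner (x + y) z = inner x z + inner y z.
Proof. by rewrite linearDl. Qed.

Lemma innerDr x y z : inner x (y + z) = inner x y + inner x z.
Proof. by rewrite linearDr. Qed.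

Lemma innerZl a x y : inner (a *: x) y = a * inner x y.
Proof. by rewrite linearZl_LR. Qed.

Lemma innerZr a x y : inner x (a *: y) = a * inner x y.
Proof. by rewrite innerC innerZl innerC. Qed.

Lemma innerNl x y : inner (- x) y = - inner x y.
Proof. by rewrite linearNl. Qed.

Lemma innerNr x y : inner x (- y) = - inner x y.
Proof. by rewrite linearNr. Qed.

Lemma inner0l x : inner 0 x = 0.
Proof. by rewrite linear0l. Qed.

Lemma inner0r x : inner x 0 = 0.
Proof. by rewrite linear0r. Qed.

Definition innerE := (innerDl, innerDr, innerNl, innerNr, innerZl, innerZr).

Lemma inner_norm_ge0 x : 0 <= inner x x.
Proof. by rewrite inner_norm sqr_ge0. Qed.

Lemma inner_eq x y : (forall h, inner x h = inner y h) -> x = y.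
Proof.
move=> xy; apply/subr0_eq/eqP; rewrite -normr_eq0 -sqrf_eq0 -inner_norm.
by rewrite innerDl innerNl xy subrr.
Qed.

(* The discriminant of the nonnegative quadratic polynomial
   t |-> <x + t y, A (x + t y)>. *)
Lemma psd_CauchySchwarz (A : E -> E) (lA : linear A) x y :
  self_adjoint A -> psd A -> inner x (A y) ^+ 2 <= inner x (A x) * inner y (A y).
Proof.
move=> sA pA; set p := inner x (A x); set q := inner y (A y).
set r := inner x (A y).
have P t : 0 <= t ^+ 2 * p + 2 * t * r + q.
  have := pA (t *: x + y); rewrite lA !innerE -/p -/q -/r.
  by rewrite -(sA y x) (innerC _ x) -/r => h; apply: le_trans h _; lra.
have p0 : 0 <= p := pA x; have q0 : 0 <= q := pA y.
have [p_eq0|p_neq0] := eqVneq p 0.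
  have [->|r0] := eqVneq r 0; first by rewrite expr0n mulr_ge0.
  have := P (- (q + 1) / (2 * r)); rewrite p_eq0 mulr0 add0r.
  have -> : 2 * (- (q + 1) / (2 * r)) * r + q = -1 by field.
  by lra.
have p_gt0 : 0 < p by rewrite lt_def p_neq0.
have := P (- r / p).
have -> : (- r / p) ^+ 2 * p + 2 * (- r / p) * r + q = (p * q - r ^+ 2) / p.
  by field.
by rewrite pmulr_lge0 ?invr_gt0// subr_ge0.
Qed.

Lemma inner_sqr_le x y : inner x y ^+ 2 <= `|x| ^+ 2 * `|y| ^+ 2.
Proof.
rewrite -!inner_norm; apply: (@psd_CauchySchwarz id) => // z.
exact: inner_norm_ge0.
Qed.

Lemma norm_inner_le x y : `|inner x y| <= `|x| * `|y|.
Proof.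
rewrite -(@ler_pXn2r _ 2) ?nnegrE ?mulr_ge0//.
by rewrite real_normK ?num_real// exprMn inner_sqr_le.
Qed.

Lemma inner_le x y : inner x y <= `|x| * `|y|.
Proof. exact: le_trans (ler_norm _) (norm_inner_le x y). Qed.

Lemma inner_ge x y : - (`|x| * `|y|) <= inner x y.
Proof. by have := norm_inner_le x y; rewrite ler_norml => /andP[]. Qed.

End InnerProduct.

Section LinearMaps.
Context (R : realType) (E F : normedModType R) (f : E -> F).
Hypothesis fl : linear f.

Lemma lin_D x y : f (x + y) = f x + f y.
Proof. by rewrite -[x in LHS]scale1r fl scale1r. Qed.

Lemma lin_0 : f 0 = 0.
Proof. by apply: (addrI (f 0)); rewrite -lin_D !addr0. Qed.

Lemma lin_Z a x : f (a *: x) = a *: f x.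
Proof. by rewrite -[a *: x]addr0 fl lin_0 addr0. Qed.

Lemma lin_N x : f (- x) = - f x.
Proof. by rewrite -scaleN1r lin_Z scaleN1r. Qed.

Lemma lin_B x y : f (x - y) = f x - f y.
Proof. by rewrite lin_D lin_N. Qed.

Lemma lin_continuous_bounded :
  continuous f -> exists2 k, 0 <= k & forall x, `|f x| <= k * `|x|.
Proof.
move=> fc; pose fL : {linear E -> F} :=
  HB.pack f (GRing.isLinear.Build _ _ _ _ f fl).
have /linear_bounded_continuous/linear_boundedP : continuous fL by [].
case=> r [rreal hr]; exists (`|r| + 1) => [|x]; first by rewrite addr_ge0.
apply: hr; rewrite (le_lt_trans (ler_norm r))// ltrDl// ltr01.
Qed.

Lemma lin_bounded_continuous k :
  (forall x, `|f x| <= k * `|x|) -> continuous f.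
Proof.
move=> fk; pose fL : {linear E -> F} :=
  HB.pack f (GRing.isLinear.Build _ _ _ _ f fl).
suff : continuous fL by [].
apply/linear_bounded_continuous/linear_boundedP.
exists k; split; first exact: num_real.
by move=> r kr x; rewrite (le_trans (fk x))// ler_wpM2r// ltW.
Qed.

(** The bound [k] makes the set under the supremum bounded above, so [opnorm f] is a genuine
    supremum; scaling [x] to the unit sphere then gives the estimate. *)
Lemma opnorm_ge k x : (forall x, `|f x| <= k * `|x|) ->
  `|f x| <= opnorm f * `|x|.
Proof.
move=> fk.
have [->|x0] := eqVneq x 0; first by rewrite lin_0 !normr0 mulr0.
have nx : 0 < `|x| by rewrite normr_gt0.
rewrite -ler_pdivrMr//.
have -> : `|f x| / `|x| = `|f (`|x|^-1 *: x)|.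
  by rewrite lin_Z normrZ ger0_norm ?invr_ge0// mulrC.
apply: ub_le_sup.
  exists `|k| => _ [y /= y1 <-].
  apply: (le_trans (fk y)); apply: (le_trans (ler_norm _)).
  by rewrite normrM normr_id ler_piMr.
exists (`|x|^-1 *: x) => //=.
by rewrite normrZ ger0_norm ?invr_ge0// mulVf ?normr_eq0.
Qed.

Lemma opnorm_ge0 k : (forall x, `|f x| <= k * `|x|) -> 0 <= opnorm f.
Proof.
move=> fk; have -> : 0 = `|f 0| by rewrite lin_0 normr0.
apply: ub_le_sup; last by exists 0 => //=; rewrite normr0.
exists `|k| => _ [y /= y1 <-].
apply: (le_trans (fk y)); apply: (le_trans (ler_norm _)).
by rewrite normrM normr_id ler_piMr.
Qed.

End LinearMaps.

(** * Sequences with geometrically decaying increments *)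

Section CauchySequences.
Context (R : realType) (E : completeNormedModType R).

Lemma cauchy_seq_cvg (u : nat -> E) :
  (forall e : R, 0 < e -> exists N, forall n m, (N <= n)%N -> (N <= m)%N ->
     `|u n - u m| < e) ->
  exists l : E, u @ \oo --> l.
Proof.
move=> uC; suff : cvgn u by move=> ?; exists (limn u).
apply/cauchy_cvgP/cauchy_ballP => e e0.
have [N hN] := uC _ e0.
exists (u @` [set n | (N <= n)%N], u @` [set n | (N <= n)%N]) => /=.
  split; exists N => // n /= Nn; by exists n.
by move=> [_ _] /= [[n Nn <-] [m Nm <-]]; rewrite -ball_normE/=; exact: hN.
Qed.

(** Increments telescope into a geometric sum. The explicit distance to the limit is what later
    transfers properties of iterates to the limit. *)
Lemma geometric_cvg (u : nat -> E) (k : R) :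
  (forall n, `|u n.+1 - u n| <= k * 2^-1 ^+ n) ->
  exists2 l : E, u @ \oo --> l & forall n, `|l - u n| <= 2 * k * 2^-1 ^+ n.
Proof.
move=> uk.
have D n m : (n <= m)%N -> `|u m - u n| <= 2 * k * 2^-1 ^+ n - 2 * k * 2^-1 ^+ m.
  move=> /subnK <-; elim: (m - n)%N => [|j IH]; first by rewrite add0n !subrr normr0.
  rewrite addSn -(subrKA (u (j + n)%N)) (le_trans (ler_normD _ _))//.
  have := uk (j + n)%N; rewrite exprS; lra.
have k0 : 0 <= k by have := uk 0%N; rewrite expr0 mulr1; exact: le_trans.
have P n : 0 <= 2 * k * 2^-1 ^+ n by rewrite !mulr_ge0// exprn_ge0.
have [l ul] : exists l : E, u @ \oo --> l.
  apply: cauchy_seq_cvg => e e0.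
  have : (fun n => 2 * k * (2^-1 : R) ^+ n) @ \oo --> 2 * k * 0.
    by apply: cvgMr; apply: cvg_expr; rewrite ger0_norm ?invr_ge0// invf_lt1// ltr1n.
  rewrite mulr0 => /cvgr0Pnorm_lt/(_ _ e0)[N _ hN].
  exists N => n m Nn Nm.
  wlog nm : n m Nn Nm / (n <= m)%N.
    move=> h; case: (leqP n m) => [|/ltnW] mn; first exact: h.
    by rewrite distrC; exact: h.
  rewrite distrC (le_lt_trans (D _ _ nm))//.
  have := hN n Nn; rewrite /= ger0_norm//; have := P m; lra.
exists l => // n.
have : (fun m => `|u m - u n|) @ \oo --> `|l - u n|.
  by apply: cvg_norm; apply: cvgB => //; exact: cvg_cst.
move=> h; apply: (cvgr_to_le h); exists n => // m /= nm.
by have := D _ _ nm; have := P m; lra.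
Qed.

End CauchySequences.

(** * Riesz representation, projections, gradients and adjoints *)

Section Riesz.
Context (R : realType) (E : hilbertType R) (S : set E).
Hypothesis cS : closed_subspace S.

(* The representative minimises x |-> |x|^2 - 2 phi x over S; the parallelogram
   identity makes minimising sequences Cauchy. *)
Lemma Riesz_subspace (phi : E -> R) (k : R) :
  linear phi -> (forall x, `|phi x| <= k * `|x|) ->
  exists2 s, S s & forall w, S w -> inner s w = phi w.
Proof.
move=> lphi phik; have [clS S0 SD] := cS.
pose J x := inner x x - 2 * phi x.
have Jge x : - k ^+ 2 <= J x.
  rewrite /J inner_norm; have := phik x; rewrite ler_norml => /andP[_ h].
  have := sqr_ge0 (`|x| - k); nra.
pose JS := [set J x | x in S].
have JS_inf : has_inf JS.
  split; first by exists (J 0), 0.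
  by exists (- k ^+ 2) => _ [x _ <-].
set m := inf JS.
have mJ x : S x -> m <= J x by move=> Sx; apply: ge_inf; [case: JS_inf|exists x].
(* The accuracy [4^-n / 4] is chosen so that the parallelogram identity at the midpoint of two
   successive points bounds their distance by [2^-n]. *)
have /choice[u uP] : forall n : nat, exists x, S x /\ J x < m + 2^-1 ^+ n ^+ 2 / 4.
  move=> n; have e0 : 0 < (2^-1 : R) ^+ n ^+ 2 / 4.
    by rewrite divr_gt0// !exprn_gt0// invr_gt0.
  by have [_ [x Sx <-] xm] := inf_adherent e0 JS_inf; exists x.
have JD x w : J (x + w) = J x + 2 * (inner x w - phi w) + inner w w.
  by rewrite /J !innerE (lin_D lphi) (innerC w x); lra.
have par n : `|u n.+1 - u n| <= 1 * 2^-1 ^+ n.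
  have [Sn Jn] := uP n; have [Sn1 Jn1] := uP n.+1.
  set v := 2^-1 *: (u n.+1 - u n).
  have e1 : u n.+1 = u n + v + v.
    by rewrite -addrA -scalerDl -[X in _ + X *: _](_ : 1 = _) ?scale1r 1?addrC ?subrK//; lra.
  have Sm : S (u n + v).
    have := SD (2^-1) _ _ (SD (-1) _ _ Sn Sn1) Sn.
    by rewrite scaleN1r [- _ + _]addrC [_ *: _ + _]addrC.
  have := mJ _ Sm.
  have := JD (u n + v) v; rewrite -e1.
  have := JD (u n + v) (- v); rewrite addrK !innerNr innerNl (lin_N lphi) => h1 h2 h3.
  have : 2 * inner v v <= 2^-1 ^+ n ^+ 2 / 2.
    by move: Jn1; rewrite [_ ^+ n.+1]exprS; have := sqr_ge0 ((2^-1 : R) ^+ n); nra.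
  rewrite inner_norm mul1r /v normrZ ger0_norm ?invr_ge0// exprMn => h.
  rewrite -(@ler_pXn2r _ 2) ?nnegrE ?exprn_ge0 ?invr_ge0//; nra.
have [s us ule] := geometric_cvg par.
have Ss : S s by apply: (closed_cvg _ clS _ _ us); near=> n; exact: (uP n).1.
exists s => // w Sw; apply/eqP; rewrite -subr_eq0; apply/negP => /negP c0.
set c := inner s w - phi w in c0.
(* Minimality is tested at [u n + t w]; replacing [u n] by its limit [s] costs terms of order
   [2^-n]. *)
have P t n : 0 <= 2 * t * c + t ^+ 2 * `|w| ^+ 2 + (2^-1 ^+ n) * (1 + 4 * `|t| * `|w|).
  have [Sn Jn] := uP n.
  have := mJ _ (SD t _ _ Sw Sn); rewrite addrC JD innerZr (lin_Z lphi) innerZl innerZr /GRing.scale/=.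
  rewrite inner_norm => h1.
  have := ule n; set e := 2^-1 ^+ n => h2.
  have e0 : 0 <= e by rewrite exprn_ge0// invr_ge0.
  have e1 : e <= 1 by rewrite exprn_ile1 ?invr_ge0// invf_le1// ler1n.
  have := norm_inner_le (s - u n) (t *: w).
  rewrite normrZ => h3.
  have : `|inner (s - u n) (t *: w)| <= 2 * e * (`|t| * `|w|).
    by apply: le_trans h3 _; rewrite ler_wpM2r ?mulr_ge0//; lra.
  rewrite ler_norml !innerE => /andP[h4 _].
  have e2 : e ^+ 2 <= e by rewrite expr2 ler_piMl.
  by move: Jn; rewrite -/e /c; lra.
(* With this [t] the quadratic in [Q] equals [- t^2 (|w|^2 + 2)], which is negative unless [c = 0];
   the summand 1 covers [w = 0]. *)
pose t := - c / (`|w| ^+ 2 + 1).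
have Q : 0 <= 2 * t * c + t ^+ 2 * `|w| ^+ 2.
  have lim : (fun n => 2 * t * c + t ^+ 2 * `|w| ^+ 2 +
      (2^-1 ^+ n) * (1 + 4 * `|t| * `|w|)) @ \oo -->
      2 * t * c + t ^+ 2 * `|w| ^+ 2 + 0 * (1 + 4 * `|t| * `|w|).
    apply: cvgD; first exact: cvg_cst.
    apply: cvgMl; apply: cvg_expr.
    by rewrite ger0_norm ?invr_ge0// invf_lt1// ltr1n.
  by rewrite mul0r addr0 in lim; apply: (cvgr_to_ge lim); near=> n; exact: P.
have d0 : 0 < `|w| ^+ 2 + 1 by rewrite ltr_wpDl ?sqr_ge0.
have tE : t * (`|w| ^+ 2 + 1) = - c by rewrite /t divfK ?gt_eqF.
have t0 : t != 0 by apply: contra c0 => /eqP t0; rewrite -oppr_eq0 -tE t0 mul0r.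
have t2 : 0 < t ^+ 2 by rewrite lt_def sqr_ge0 sqrf_eq0 t0.
have : c = - (t * (`|w| ^+ 2 + 1)) by rewrite tE opprK.
have := sqr_ge0 `|w|; nra.
Unshelve. all: by end_near.
Qed.

(** The projection of [x] is the representative in [S] of the functional [inner x], so the default
    value of [orth_proj] is not what is chosen here. *)
Lemma orth_projP x :
  S (orth_proj S x) /\ forall w, S w -> inner (x - orth_proj S x) w = 0.
Proof.
suff [p Sp pP] : exists2 p, S p & forall w, S w -> inner p w = inner x w.
  apply: (@xgetPex _ 0 [set p | S p /\ forall w, S w -> inner (x - p) w = 0]).
  by exists p; split=> // w Sw; rewrite innerDl innerNl pP// subrr.
apply: (@Riesz_subspace _ `|x|) => [a y z|y]; last exact: norm_inner_le.
by rewrite innerDr innerZr.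
Qed.

End Riesz.

Lemma closed_subspace_setT (R : realType) (E : normedModType R) :
  closed_subspace (setT : set E).
Proof. by split => //; exact: closedT. Qed.

Section RieszFull.
Context (R : realType) (E : hilbertType R).

Lemma Riesz (phi : E -> R) (k : R) :
  linear phi -> (forall x, `|phi x| <= k * `|x|) ->
  exists s, forall w, inner s w = phi w.
Proof.
move=> lphi phik.
have [s _ sP] := Riesz_subspace (@closed_subspace_setT R E) lphi phik.
by exists s => w; exact: sP.
Qed.

Lemma gradP (V : E -> R) x : differentiable V x ->
  forall h, 'd V x h = inner (grad V x) h.
Proof.
move=> dV; apply: (@xgetPex _ 0 [set g | forall h, 'd V x h = inner g h]).
have dl : linear ('d V x : E -> R) by move=> a y z; rewrite linearP.
have [k _ kP] := lin_continuous_bounded dl (diff_continuous dV).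
by have [s sP] := Riesz dl kP; exists s => h; exact/esym/sP.
Qed.

Lemma grad_unique (V : E -> R) x g : differentiable V x ->
  (forall h, 'd V x h = inner g h) -> grad V x = g.
Proof. by move=> dV gP; apply: inner_eq => h; rewrite -gradP. Qed.

End RieszFull.

Section Adjoint.
Context (R : realType) (U E : hilbertType R) (B : U -> E) (k : R).
Hypotheses (lB : linear B) (Bk : forall x, `|B x| <= k * `|x|).

Lemma adjointP x y : inner (B x) y = inner x (adjoint B y).
Proof.
move: x; apply: (@xgetPex _ 0 [set z | forall x, inner (B x) y = inner x z]).
have [||s sP] := @Riesz _ _ (fun x => inner (B x) y) (k * `|y|).
- by move=> a u v; rewrite lB innerDl innerZl.
- move=> x; apply: le_trans (norm_inner_le _ _) _.
  by rewrite mulrAC ler_wpM2r.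
by exists s => x; rewrite [RHS]innerC sP.
Qed.

Lemma adjoint_linear : linear (adjoint B).
Proof.
move=> a x y; apply: inner_eq => h.
rewrite innerC -adjointP !innerDr innerZr !adjointP [RHS]innerC.
by rewrite innerDr innerZr.
Qed.

Lemma adjoint_bound y : 0 <= k -> `|adjoint B y| <= k * `|y|.
Proof.
move=> k0; have [->|n0] := eqVneq `|adjoint B y| 0; first by rewrite mulr_ge0.
have n_gt0 : 0 < `|adjoint B y| by rewrite lt_def n0 /=.
rewrite -(ler_pM2r n_gt0) -expr2 -inner_norm -adjointP.
apply: le_trans (inner_le _ _) _.
by rewrite mulrAC ler_wpM2r.
Qed.

End Adjoint.

Section ClosedRange.
Context (R : realType) (U E : hilbertType R) (B : {linear U -> E}).
Hypotheses (B_cont : continuous B) (B_closed_range : closed (range B)).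

(* Uniform boundedness applied to the functionals <y, .> with y in ran B and
   |B^* y| <= 1: on ran B these are bounded pointwise, and the orthogonal
   projection onto ran B reduces every point to that case. *)
Lemma adjoint_bounded_below :
  exists2 b : R, 0 < b & forall w, range B w -> b * `|w| ^+ 2 <= `|adjoint B w| ^+ 2.
Proof.
have lB : linear B by move=> a x y; rewrite linearP.
have [k k0 Bk] := lin_continuous_bounded lB B_cont.
have sub : closed_subspace (range B).
  split => //; first by exists 0; rewrite ?linear0.
  by move=> a _ _ [x _ <-] [y _ <-]; exists (a *: x + y); rewrite ?linearP.
have lA := adjoint_linear lB Bk.
pose F : set (E -> R) := [set inner y | y in [set y | range B y /\ `|adjoint B y| <= 1]].
have [||M MP] := @Banach_Steinhauss R E R F _ _ 1.
- move=> _ [y _ <-]; split => [r|a u v]; last by rewrite innerDr innerZr.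
  exists (`|y| * r) => x xr; apply: le_trans (norm_inner_le _ _) _.
  by rewrite ler_wpM2l.
- move=> x; have [[u _ uE] px] := orth_projP sub x.
  exists `|u| => _ [y [ry y1] <-].
  have -> : inner y x = inner (adjoint B y) u.
    have := px _ ry; rewrite innerC innerDr innerNr => /eqP; rewrite subr_eq0 => /eqP ->.
    by rewrite -uE innerC (adjointP lB Bk) innerC.
  apply: le_trans (norm_inner_le _ _) _; by rewrite ler_piMl.
have M'0 : 0 < `|M| + 1 by rewrite ltr_wpDl.
(* Banach-Steinhaus bounds all these functionals by one [M] on the unit ball; testing [inner y] at
   [y / |y|] turns this into a bound on [|y|]. *)
have yM y : range B y -> `|adjoint B y| <= 1 -> `|y| <= `|M| + 1.
  move=> ry y1; have [->|y0] := eqVneq y 0; first by rewrite normr0 ltW.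
  have ny : 0 < `|y| by rewrite normr_gt0.
  have Fy : F (inner y) by exists y.
  have := MP _ Fy (`|y|^-1 *: y).
  rewrite normrZ ger0_norm ?invr_ge0// mulVf ?gt_eqF// => /(_ (lexx _)).
  rewrite innerZr inner_norm expr2 mulKf ?gt_eqF// normr_id => h.
  by apply: le_trans h _; have := ler_norm M; lra.
exists ((`|M| + 1) ^- 2); first by rewrite invr_gt0 exprn_gt0.
move=> w rw; rewrite mulrC ler_pdivrMr ?exprn_gt0// -exprMn.
rewrite ler_pXn2r ?nnegrE ?mulr_ge0 ?(ltW M'0)//.
have rZ a : range B (a *: w).
  by case: rw => x _ <-; exists (a *: x); rewrite ?linearZ.
have [a0|a0] := eqVneq `|adjoint B w| 0.
  rewrite a0 mul0r; suff -> : w = 0 by rewrite normr0.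
  (* If the adjoint annihilated some [w != 0], the multiple of [w] of norm [|M| + 2] would violate
     [yM]. *)
  apply/eqP/negPn/negP => w0; have nw : 0 < `|w| by rewrite normr_gt0.
  have := yM _ (rZ ((`|M| + 2) / `|w|)).
  rewrite (lin_Z lA) !normrZ a0 mulr0 => /(_ ler01).
  rewrite normfV normr_id divfK ?gt_eqF// ger0_norm; lra.
have a_gt0 : 0 < `|adjoint B w| by rewrite lt_def a0 /=.
have := yM _ (rZ `|adjoint B w|^-1).
rewrite (lin_Z lA) !normrZ !normfV !normr_id mulVf// => /(_ (lexx _)).
by rewrite mulrC ler_pdivrMr// mulrC.
Qed.

End ClosedRange.

(** * Inverses and square roots near the identity *)

(** Passes identities to a limit: their defect is shown to be at most a multiple of [2^-n] for every
    [n]. *)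
Lemma le_geometric_eq0 (R : realType) (E : normedModType R) (x : E) (k : R) :
  (forall n, `|x| <= k * 2^-1 ^+ n) -> x = 0.
Proof.
move=> xk; apply/eqP; rewrite -normr_le0.
have lim : (fun n => k * (2^-1 : R) ^+ n) @ \oo --> k * 0.
  by apply: cvgMr; apply: cvg_expr; rewrite ger0_norm ?invr_ge0// invf_lt1// ltr1n.
by rewrite mulr0 in lim; apply: (cvgr_to_ge lim); near=> n; exact: xk.
Unshelve. all: by end_near.
Qed.

(** A linear identity between vectors is paired with an arbitrary vector [h], which makes it a
    scalar identity within reach of [lra]. *)
Ltac vector_eq := let h := fresh "h" in
  apply: inner_eq => h; rewrite !innerE ?inner0l; lra.

Section NearIdentity.
Context (R : realType) (E : hilbertType R) (K : E -> E) (q : R).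
Hypotheses (lK : linear K) (q0 : 0 <= q) (q1 : q <= 2^-1).
Hypothesis Kq : forall x, `|K x| <= q * `|x|.

Let K_half x : `|K x| <= 2^-1 * `|x|.
Proof. by apply: le_trans (Kq x) _; rewrite ler_wpM2r. Qed.

Lemma sub_id_inj x y : x - K x = y - K y -> x = y.
Proof.
move=> xy; apply/subr0_eq/eqP; rewrite -normr_le0.
have e : x - y = K (x - y).
  rewrite (lin_B lK) -{1}(subrK (K x) x) xy.
  by vector_eq.
by have := K_half (x - y); rewrite -e; lra.
Qed.

(** Neumann iteration: [u |-> y + K u] contracts distances by 1/2, and its limit solves the
    equation. *)
Lemma sub_id_surj y : exists x, x - K x = y.
Proof.
pose u := fix u n := if n is n'.+1 then y + K (u n') else 0.
have uD n : `|u n.+1 - u n| <= `|y| * 2^-1 ^+ n.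
  elim: n => [|n IH]; first by rewrite /= (lin_0 lK) addr0 subr0 expr0 mulr1.
  have -> : u n.+2 - u n.+1 = K (u n.+1 - u n).
    by rewrite (lin_B lK) /=; vector_eq.
  apply: le_trans (Kq _) _; rewrite exprS mulrCA.
  by apply: ler_pM.
have [x _ xu] := geometric_cvg uD.
exists x; apply/subr0_eq/(@le_geometric_eq0 _ _ _ (4 * `|y|)) => n.
have -> : x - K x - y = (x - u n.+1) - K (x - u n).
  by rewrite (lin_B lK) /=; vector_eq.
apply: le_trans (ler_normB _ _) _.
have := K_half (x - u n); have := xu n; have := xu n.+1; rewrite exprS.
have : 0 <= `|y| * 2^-1 ^+ n by rewrite mulr_ge0// exprn_ge0// invr_ge0.
lra.
Qed.

End NearIdentity.

Lemma opinvP (R : realType) (E : normedModType R) (f : E -> E) :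
  injective f -> (forall y, exists x, f x = y) ->
  cancel f (opinv f) /\ cancel (opinv f) f.
Proof.
move=> fi fs; have fK : cancel f (opinv f).
  by move=> x; apply: pinvKV; rewrite ?inE// => ? ? _ _; exact: fi.
by split => // y; have [x <-] := fs y; rewrite fK.
Qed.

Section SquareRoot.
Context (R : realType) (E : hilbertType R).

Section SqrtNearIdentity.
Context (K : E -> E) (q : R).
Hypotheses (lK : linear K) (sK : self_adjoint K) (q0 : 0 <= q) (q1 : q <= 2^-1).
Hypothesis Kq : forall x, `|K x| <= q * `|x|.

(* Fixed-point iteration for Y = (K + Y^2) / 2, that is, (1 - Y)^2 = 1 - K. *)
Let Yn := fix Yn (n : nat) (x : E) : E :=
  if n is n'.+1 then 2^-1 *: (K x + Yn n' (Yn n' x)) else 0.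

Let q_half (z : R) : 0 <= z -> q * z <= 2^-1 * z.
Proof. by move=> z0; rewrite ler_wpM2r. Qed.

Let YnS n x : Yn n.+1 x = 2^-1 *: (K x + Yn n (Yn n x)).
Proof. by []. Qed.

Let Yn_linear n : linear (Yn n).
Proof.
elim: n => [|n IH] a x y; first by rewrite /= scaler0 addr0.
by rewrite !YnS lK !IH; vector_eq.
Qed.

Let Yn_le n x : `|Yn n x| <= q * `|x|.
Proof.
elim: n x => [|n IH] x; first by rewrite /= normr0 mulr_ge0.
rewrite YnS normrZ ger0_norm ?invr_ge0//.
have h : q * `|Yn n x| <= 1 * (q * `|x|) by apply: ler_pM => //; rewrite ?IH ?(le_trans q1) ?invf_le1 ?ler1n.
have := ler_normD (K x) (Yn n (Yn n x)); have := Kq x; have := IH (Yn n x); lra.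
Qed.

Let Yn_sa n : self_adjoint (Yn n).
Proof.
elim: n => [|n IH] x y; first by rewrite /= inner0l inner0r.
by rewrite !YnS !innerE sK IH IH.
Qed.

Let Yn_cauchy n x : `|Yn n.+1 x - Yn n x| <= `|x| * 2^-1 ^+ n.
Proof.
elim: n x => [|n IH] x.
  rewrite YnS /= addr0 subr0 expr0 mulr1 normrZ ger0_norm ?invr_ge0//.
  by have := q_half (normr_ge0 x); have := Kq x; have := normr_ge0 x; lra.
(* The difference of squares is split as [Y' (Y' - Y) + (Y' - Y) Y] with [Y' = Yn n.+1] and
   [Y = Yn n]; each product gains a factor [q <= 1/2]. *)
have -> : Yn n.+2 x - Yn n.+1 x = 2^-1 *: (Yn n.+1 (Yn n.+1 x - Yn n x) +
    (Yn n.+1 (Yn n x) - Yn n (Yn n x))).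
  by rewrite (lin_B (@Yn_linear n.+1)) (YnS n.+1) [X in _ - X]YnS; vector_eq.
rewrite normrZ ger0_norm ?invr_ge0//.
apply: (@le_trans _ _ (2^-1 * (q * (`|x| * 2^-1 ^+ n) + q * `|x| * 2^-1 ^+ n))).
  rewrite ler_wpM2l ?invr_ge0//; apply: le_trans (ler_normD _ _) _.
  apply: lerD; first by apply: le_trans (Yn_le _ _) _; rewrite ler_wpM2l.
  by apply: le_trans (IH _) _; rewrite ler_wpM2r ?exprn_ge0 ?invr_ge0.
rewrite exprS; set e := 2^-1 ^+ n.
have : 0 <= `|x| * e by rewrite mulr_ge0// exprn_ge0 ?invr_ge0.
by move=> /[dup]/q_half; lra.
Qed.

Lemma sqrt_near_id : exists Y : E -> E, [/\ linear Y, self_adjoint Y,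
  forall x, `|Y x| <= q * `|x| & forall x, Y x = 2^-1 *: (K x + Y (Y x))].
Proof.
have /choice[Y YP] x : exists y, Yn ^~ x @ \oo --> y /\
    forall n, `|y - Yn n x| <= 2 * `|x| * 2^-1 ^+ n.
  by have [y ? ?] := geometric_cvg (Yn_cauchy ^~ x); exists y.
have YE x n := (YP x).2 n.
have lY : linear Y.
  move=> a x y; apply/subr0_eq/(@le_geometric_eq0 _ _ _
    (2 * `|a *: x + y| + `|a| * (2 * `|x|) + 2 * `|y|)) => n.
  have -> : Y (a *: x + y) - (a *: Y x + Y y) = (Y (a *: x + y) - Yn n (a *: x + y))
     - a *: (Y x - Yn n x) - (Y y - Yn n y).
    by rewrite (@Yn_linear n); vector_eq.
  have := ler_normB (Y (a *: x + y) - Yn n (a *: x + y) - a *: (Y x - Yn n x))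
    (Y y - Yn n y).
  have := ler_normB (Y (a *: x + y) - Yn n (a *: x + y)) (a *: (Y x - Yn n x)).
  rewrite normrZ.
  have := YE (a *: x + y) n; have := YE y n.
  have : `|a| * `|Y x - Yn n x| <= `|a| * (2 * `|x| * 2^-1 ^+ n) by rewrite ler_wpM2l.
  lra.
have Yq x : `|Y x| <= q * `|x|.
  have lim : (fun n => `|Yn n x|) @ \oo --> `|Y x| by apply: cvg_norm; exact: (YP x).1.
  by apply: (cvgr_to_le lim); near=> n; exact: Yn_le.
exists Y; split => //.
  move=> x y; apply/subr0_eq/(@le_geometric_eq0 R R^o _ (4 * `|x| * `|y|)) => n.
  have -> : inner (Y x) y - inner x (Y y) =
      inner (Y x - Yn n x) y - inner x (Y y - Yn n y).
    by rewrite !innerE (@Yn_sa n); ring.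
  apply: le_trans (ler_normB _ _) _.
  have := norm_inner_le (Y x - Yn n x) y; have := norm_inner_le x (Y y - Yn n y).
  have : `|Y x - Yn n x| * `|y| <= 2 * `|x| * 2^-1 ^+ n * `|y| by rewrite ler_wpM2r.
  have : `|x| * `|Y y - Yn n y| <= `|x| * (2 * `|y| * 2^-1 ^+ n) by rewrite ler_wpM2l.
  lra.
move=> x; apply/subr0_eq/(@le_geometric_eq0 _ _ _ (4 * `|x|)) => n.
have -> : Y x - 2^-1 *: (K x + Y (Y x)) = (Y x - Yn n.+1 x) -
   2^-1 *: ((Y (Y x) - Yn n (Y x)) + Yn n (Y x - Yn n x)).
  by rewrite YnS (lin_B (@Yn_linear n)); vector_eq.
apply: le_trans (ler_normB _ _) _; rewrite normrZ ger0_norm ?invr_ge0//.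
have := ler_normD (Y (Y x) - Yn n (Y x)) (Yn n (Y x - Yn n x)).
have := Yn_le n (Y x - Yn n x); have := YE (Y x) n; have := YE x n.
have := YE x n.+1; rewrite exprS; have := Yq x; have := normr_ge0 x.
set e := 2^-1 ^+ n; have e0 : 0 <= e by rewrite exprn_ge0// invr_ge0.
have : 0 <= `|x| * e by rewrite mulr_ge0.
move=> xe x0 h1 h2 h3 h4 h5 h6.
have : 2 * `|Y x| * e <= `|x| * e by rewrite ler_wpM2r//; have := q_half x0; lra.
have : q * `|Y x - Yn n x| <= 2^-1 * (2 * `|x| * e) by exact: ler_pM.
lra.
Unshelve. all: by end_near.
Qed.

End SqrtNearIdentity.

(** For [K = 1 - f] the fixed point [Y] of [Y = (K + Y^2) / 2] gives [(1 - Y)^2 = 1 - K = f], and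
    [|Y| <= 1/2] makes [1 - Y] positive. So the set from which [opsqrt] chooses is nonempty. *)
Lemma opsqrtP (f : E -> E) (q : R) : linear f -> self_adjoint f ->
  0 <= q <= 2^-1 -> (forall x, `|x - f x| <= q * `|x|) ->
  [/\ linear (opsqrt f), continuous (opsqrt f), self_adjoint (opsqrt f),
      psd (opsqrt f) & opsqrt f \o opsqrt f = f].
Proof.
move=> lf sf /andP[q0 q1] fq.
apply: (@xgetPex _ (fun=> 0) [set S : E -> E |
    [/\ linear S, continuous S, self_adjoint S, psd S & S \o S = f]]).
have lK : linear (fun x => x - f x).
  by move=> a x y; rewrite lf scalerBr opprD addrACA.
have sK : self_adjoint (fun x => x - f x).
  by move=> x y; rewrite !innerE sf.
have [Y [lY sY Yq YE]] := sqrt_near_id lK sK q0 q1 fq.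
exists (fun x => x - Y x); split.
- by move=> a x y; rewrite lY scalerBr opprD addrACA.
- apply: (@lin_bounded_continuous _ _ _ _ _ (1 + q)).
    by move=> a x y; rewrite lY scalerBr opprD addrACA.
  by move=> x; have := ler_normB x (Y x); have := Yq x; lra.
- by move=> x y; rewrite !innerE sY.
- move=> x; rewrite !innerE inner_norm; have := inner_le x (Y x).
  have : `|x| * `|Y x| <= `|x| * (2^-1 * `|x|).
    by rewrite ler_wpM2l// (le_trans (Yq x))// ler_wpM2r.
  by have := sqr_ge0 `|x|; lra.
- apply/funext => x /=; rewrite (lin_B lY) [X in x - X - _]YE.
  set y := Y (Y x); rewrite [X in _ - (X - _)]YE -/y; vector_eq.
Qed.

End SquareRoot.

(** * The operators T, T^-1 and T^(-1/2) *)

(** Cauchy-Schwarz for the form [<., A .>] at [A x] and [x] gives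
    [|A x|^4 <= <A x, A A x> <x, A x>]; dividing by [|A x|^2] leaves the factor [a]. *)
Lemma psd_sqr_norm_le (R : realType) (E : hilbertType R) (A : E -> E) (a : R) :
  linear A -> self_adjoint A -> psd A -> 0 <= a ->
  (forall x, `|A x| <= a * `|x|) -> forall x, `|A x| ^+ 2 <= a * inner x (A x).
Proof.
move=> lA sA pA a0 Aa x.
have [n0|n0] := eqVneq (`|A x| ^+ 2) 0; first by rewrite n0 mulr_ge0// pA.
have n_gt0 : 0 < `|A x| ^+ 2 by rewrite lt_def n0 sqr_ge0.
rewrite -(ler_pM2l n_gt0).
have := psd_CauchySchwarz lA (A x) x sA pA.
rewrite inner_norm -expr2 => h; apply: le_trans h _.
have : inner (A x) (A (A x)) <= `|A x| * (a * `|A x|).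
  by apply: le_trans (inner_le _ _) _; rewrite ler_wpM2l.
have := pA x; nra.
Qed.

(** Applied with [A = B B^*], [a] its operator norm and [r = c2]; [damping_small] is the upper bound
    on [rho] for [alpha = 1/66]. *)
Record small_damping (R : realType) (E : hilbertType R) (A : E -> E) (a r : R)
    : Prop := {
  damping_linear : linear A;
  damping_sa : self_adjoint A;
  damping_psd : psd A;
  damping_ge0 : 0 <= a;
  damping_bound : forall x, `|A x| <= a * `|x|;
  damping_gt0 : 0 < r;
  damping_small : r * a <= 1 / 66
}.

Section Resolvent.
Context (R : realType) (E : hilbertType R) (A : E -> E) (a r : R).
Hypothesis HA : small_damping A a r.

Let lA : linear A := damping_linear HA.
Let sA : self_adjoint A := damping_sa HA.
Let pA : psd A := damping_psd HA.
Let a0 : 0 <= a := damping_ge0 HA.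
Let Aa : forall x, `|A x| <= a * `|x| := damping_bound HA.
Let r0 : 0 < r := damping_gt0 HA.
Let ra : r * a <= 1 / 66 := damping_small HA.

Let T (x : E) := x - r *: A x.
Let Ti := opinv T.
Let S := opsqrt Ti.

Let rA_le x : `|r *: A x| <= 1 / 66 * `|x|.
Proof.
rewrite normrZ gtr0_norm// (le_trans (ler_wpM2l (ltW r0) (Aa x)))//.
by rewrite mulrA ler_wpM2r.
Qed.

Let rA_linear : linear (fun x => r *: A x).
Proof. by move=> b x y; rewrite lA; vector_eq. Qed.

Lemma resolvent_linear : linear T.
Proof. by move=> b x y; rewrite /T lA; vector_eq. Qed.

Lemma resolvent_sa : self_adjoint T.
Proof. by move=> x y; rewrite /T !innerE sA. Qed.

Lemma resolventK : cancel T Ti /\ cancel Ti T.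
Proof.
have q0 : 0 <= 1 / 66 :> R by lra.
have q1 : 1 / 66 <= 2^-1 :> R by lra.
apply: opinvP => [x y|y].
  exact: (sub_id_inj rA_linear q1 rA_le).
exact: (sub_id_surj rA_linear q0 q1 rA_le).
Qed.

Let TK := resolventK.1.
Let TiK := resolventK.2.

Lemma opinv_resolvent_linear : linear Ti.
Proof.
by move=> b x y; rewrite -[RHS]TK resolvent_linear !TiK.
Qed.

Lemma opinv_resolvent_sa : self_adjoint Ti.
Proof. by move=> x y; rewrite -{2}(TiK x) resolvent_sa TiK. Qed.

Lemma opinv_resolvent_comm x : Ti (A x) = A (Ti x).
Proof.
rewrite -[RHS]TK; congr Ti.
by rewrite -{1}(TiK x) /T !(lin_B lA) !(lin_Z lA).
Qed.

Lemma norm_opinv_resolvent x : `|Ti x| <= 66 / 65 * `|x|.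
Proof.
have := rA_le (Ti x); have := ler_normD (T (Ti x)) (r *: A (Ti x)).
by rewrite {1}/T subrK TiK; lra.
Qed.

Lemma sqrt_resolventP : [/\ linear S, continuous S, self_adjoint S,
  psd S & forall x, S (S x) = Ti x].
Proof.
(* The distance of [T^-1] from the identity is that of [r A T^-1] from 0, at most
   [1/66 * 66/65 = 1/65]. *)
have [|x|lS cS sS pS SS] := opsqrtP (q := 1 / 65) opinv_resolvent_linear opinv_resolvent_sa.
- by lra.
- have -> : x - Ti x = - (r *: A (Ti x)).
    by rewrite -{1}(TiK x) /T; vector_eq.
  by rewrite normrN; have := rA_le (Ti x); have := norm_opinv_resolvent x; lra.
by split => // x; rewrite -[RHS](congr1 (@^~ x) SS).
Qed.

(* S commutes with S^2 = T^-1, hence with T, hence with A as r != 0. *)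
Lemma sqrt_resolvent_comm x : S (A x) = A (S x).
Proof.
have [lS _ _ _ SS] := sqrt_resolventP.
have STi y : S (Ti y) = Ti (S y) by rewrite -!SS.
have ST y : S (T y) = T (S y) by rewrite -[RHS](congr1 T (congr1 S (TK y))) STi TiK.
have := ST x; rewrite /T (lin_B lS) (lin_Z lS) => /addrI/oppr_inj.
by apply: scalerI; rewrite gt_eqF.
Qed.

Let AAn x : `|A x| ^+ 2 <= a * inner x (A x).
Proof. exact: psd_sqr_norm_le. Qed.

(** [<x, T x> - |T x|^2 = r (<x, A x> - r |A x|^2)], and [r |A x|^2 <= r a <x, A x>] with
    [r a < 1]. *)
Lemma resolvent_sqr_le x : `|T x| ^+ 2 <= inner x (T x).
Proof.
rewrite -inner_norm /T !innerE (innerC (A x) x) (inner_norm (A x)).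
have := AAn x; have := pA x.
have : r * a * inner x (A x) <= 1 / 66 * inner x (A x) by rewrite ler_wpM2r.
have h2 : r * `|A x| ^+ 2 <= r * (a * inner x (A x)) by rewrite ler_wpM2l// ltW.
move=> h1 h3 h4.
suff : r * (r * `|A x| ^+ 2) <= r * inner x (A x) by lra.
by rewrite ler_wpM2l ?(ltW r0)//; lra.
Qed.

Lemma norm_resolvent_le x : `|T x| <= `|x|.
Proof.
have [->|n0] := eqVneq `|T x| 0; first by [].
have n_gt0 : 0 < `|T x| by rewrite lt_def n0/=.
rewrite -(ler_pM2r n_gt0) -expr2; exact: le_trans (resolvent_sqr_le x) (inner_le _ _).
Qed.

Lemma opinv_resolvent_ge x : `|x| ^+ 2 <= inner x (Ti x).
Proof.
by rewrite -{1 2}(TiK x) (innerC (T _)); exact: resolvent_sqr_le.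
Qed.

Let D x := A (Ti x).

Lemma A_opinv_linear : linear D.
Proof. by move=> b x y; rewrite /D opinv_resolvent_linear lA. Qed.

Lemma A_opinv_sa : self_adjoint D.
Proof. by move=> x y; rewrite /D sA opinv_resolvent_sa opinv_resolvent_comm. Qed.

Lemma A_opinv_sqrt x : inner x (D x) = inner (S x) (A (S x)).
Proof.
have [_ _ sS _ SS] := sqrt_resolventP.
by rewrite sS sqrt_resolvent_comm SS.
Qed.

Lemma A_opinv_psd : psd D.
Proof. by move=> x; rewrite A_opinv_sqrt; exact: pA. Qed.

Lemma A_opinv_bound x : `|D x| <= 2 * a * `|x|.
Proof.
apply: le_trans (Aa _) _.
have := ler_wpM2l a0 (norm_opinv_resolvent x); have : 0 <= a * `|x| by rewrite mulr_ge0.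
by lra.
Qed.

(** For [x = T y] the right side minus the left is [r (|A y|^2 - r <A y, A A y>)], nonnegative since
    [r a <= 1/66]. *)
Lemma A_le_A_opinv x : inner x (A x) <= inner x (D x).
Proof.
set y := Ti x; rewrite -(TiK x) -/y /D /T TK -/y.
have e2 : inner y (A (A y)) = `|A y| ^+ 2 by rewrite -sA inner_norm.
have e3 : inner y (A (A (A y))) = inner (A y) (A (A y)) by rewrite -sA.
rewrite (lin_B lA) (lin_Z lA) !innerE !sA e2 e3.
have : r * inner (A y) (A (A y)) <= 1 / 66 * `|A y| ^+ 2.
  have : inner (A y) (A (A y)) <= `|A y| * (a * `|A y|).
    by apply: le_trans (inner_le _ _) _; rewrite ler_wpM2l.
  move=> /(ler_wpM2l (ltW r0)) h; apply: le_trans h _.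
  have : r * a * `|A y| ^+ 2 <= 1 / 66 * `|A y| ^+ 2 by rewrite ler_wpM2r ?sqr_ge0.
  lra.
move=> h2; suff : 0 <= r * (`|A y| ^+ 2 - r * inner (A y) (A (A y))) by lra.
by rewrite mulr_ge0 ?(ltW r0)//; have := sqr_ge0 `|A y|; lra.
Qed.

(** From [T = 1 - r A] and [T^-1 = 1 + r A T^-1] the difference is [- r <x, A x> - r <x, D x>]. This
    supplies the damping in the energy balance. *)
Lemma kinetic_le x : inner x (T x) - inner x (Ti x) <= - (r * inner x (D x)).
Proof.
have -> : Ti x = x + r *: D x by rewrite -{2}(TiK x) /T /D; vector_eq.
rewrite /T !innerE; have := mulr_ge0 (ltW r0) (pA x); lra.
Qed.

(** The value 1/66 enters the energy balance here: [r^2 |A x|^2 <= (r a) r <x, A x>], and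
    [A <= A T^-1]. *)
Lemma A_sqr_norm_le x : r * (r * `|A x| ^+ 2) <= 1 / 66 * (r * inner x (D x)).
Proof.
have h := ler_wpM2l (ltW r0) (AAn x); have rr := mulr_ge0 (ltW r0) (ltW r0).
have h1 : r * a * inner x (A x) <= 1 / 66 * inner x (D x).
  by rewrite ler_pM ?pA ?mulr_ge0 ?(ltW r0)// A_le_A_opinv.
rewrite [leRHS]mulrCA ler_wpM2l ?(ltW r0)//; lra.
Qed.

Lemma resolvent_A_comm x : T (A x) = A (T x).
Proof. by rewrite /T (lin_B lA) (lin_Z lA). Qed.

(** Used with [r = c2], [t = dt], [s = c1]. As [S A S = A T^-1], the damping contributes [- r A x],
    which combines with [x] to [T x]. *)
Lemma euler_velocity (t s : R) (x p g : E) : r = t * s ->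
  x - t *: T (p + s *: S (A (S x))) - t *: T g = T (x - t *: p - t *: g).
Proof.
move=> rts; have [_ _ _ _ SS] := sqrt_resolventP.
have lT := resolvent_linear.
have -> : S (A (S x)) = A (Ti x) by rewrite sqrt_resolvent_comm SS.
rewrite (lin_D lT) !(lin_B lT) !(lin_Z lT) resolvent_A_comm TiK [T x]/T.
by move: (T p) (T g) => y z; rewrite rts; vector_eq.
Qed.

End Resolvent.

(** * Gradients *)

Section Gradient.
Context (R : realType) (E : hilbertType R).

Lemma grad_expansion (f : E -> R) (x g : E) (k : R) :
  (forall h, `|f (x + h) - f x - inner g h| <= k * `|h| ^+ 2) ->
  grad f x = g.
Proof.
move=> fk.
have lg : linear (inner g : E -> R) by move=> a u v; rewrite innerDr innerZr.
pose G : {linear E -> R} := HB.pack (inner g : E -> R)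
  (GRing.isLinear.Build _ _ _ _ (inner g : E -> R) lg).
have Gc : continuous G by apply: (lin_bounded_continuous lg (norm_inner_le g)).
have expn : f \o shift x = cst (f x) + G +o_ 0 id.
  apply/eqaddoP => _/posnumP[e].
  have d0 : 0 < e%:num / (`|k| + 1) by rewrite divr_gt0// ltr_wpDl.
  near=> h.
  have -> : (f \o shift x - (cst (f x) + G)) h = f (x + h) - f x - inner g h.
    by rewrite (addrC x h) -addrA -opprD.
  apply: le_trans (fk h) _; rewrite expr2 mulrA ler_wpM2r//=.
  have : `|h| < e%:num / (`|k| + 1) by near: h; exact: nbhs0_lt.
  rewrite ltr_pdivlMr ?ltr_wpDl// => hk.
  have := ler_norm k; have := normr_ge0 h; nra.
have dfE := diff_unique Gc expn.
apply: grad_unique => [|h]; last by rewrite dfE.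
by apply/diff_locallyP; rewrite dfE.
Unshelve. all: by end_near.
Qed.

Lemma mean_value_grad (f : E -> R) x h : (forall y, differentiable f y) ->
  exists2 t, 0 <= t <= 1 & f (x + h) - f x = inner (grad f (x + t *: h)) h.
Proof.
move=> df; pose p (t : R) := f (x + t *: h).
have dp (t : R) : is_derive t 1 p (inner (grad f (x + t *: h)) h).
  have D1 : is_diff t (fun t : R => x + t *: h) (fun s : R => s *: h).
    have D0 := is_diffD (is_diff_cst x t) (is_diff_scalel t h).
    apply: (is_diff_eq D0).
    by apply/funext => s; rewrite fctE add0r.
  have D2 : is_diff (x + t *: h) f ('d f (x + t *: h)) by apply: DiffDef.
  have D3 : is_diff t p ('d f (x + t *: h) \o (fun s : R => s *: h)).
    exact: is_diff_comp.
  apply: DeriveDef; first exact/derivable1_diffP/ex_diff.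
  by rewrite deriveE ?diff_val/= ?scale1r ?gradP//; exact: ex_diff.
have [|t t01 ht] := @MVT_segment R p _ 0 1 ler01 (fun t _ => dp t).
  by apply: derivable_within_continuous => t _; exact: ex_derive.
exists t; first by rewrite in_itv in t01.
by move: ht; rewrite /p scale1r scale0r addr0 subr0 mulr1.
Qed.

Lemma grad_lipschitz_le (f : E -> R) (L : R) : (forall y, differentiable f y) ->
  0 <= L -> (forall x y, `|grad f x - grad f y| <= L * `|x - y|) ->
  forall x h, f (x + h) <= f x + inner (grad f x) h + L * `|h| ^+ 2.
Proof.
move=> df L0 fL x h; have [t /andP[t0 t1] ht] := mean_value_grad x h df.
suff : inner (grad f (x + t *: h)) h - inner (grad f x) h <= L * `|h| ^+ 2 by lra.
rewrite -innerNl -innerDl; apply: le_trans (inner_le _ _) _.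
rewrite expr2 mulrA ler_wpM2r// (le_trans (fL _ _))// ler_wpM2l//.
by rewrite addrC addKr normrZ ger0_norm// ler_piMl.
Qed.

Section Quadratic.
Context (D : E -> E) (k : R) (x0 g0 : E) (c : R).
Hypotheses (lD : linear D) (sD : self_adjoint D) (pD : psd D).
Hypotheses (Dk : forall x, `|D x| <= k * `|x|) (c0 : 0 <= c).

(** With [D = A T^-1] and [c = c3] this is the added potential of both parts; its second-order
    expansion [f_add] is exact. *)
Let f x := c / 2 * inner (x - x0) (D (x - x0)) - inner g0 (x - x0).
Let g x := c *: D (x - x0) - g0.

Let f_add x h : f (x + h) = f x + inner (g x) h + c / 2 * inner h (D h).
Proof.
have -> : x + h = (x - x0) + h + x0 by rewrite addrAC subrK.
rewrite /f /g addrK; move: (x - x0) => y.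
by rewrite (lin_D lD) !innerE (innerC h (D y)) !sD; lra.
Qed.

Lemma grad_quadratic x : grad f x = g x.
Proof.
apply: (@grad_expansion _ _ _ (c / 2 * k)) => h.
rewrite f_add.
have -> : f x + inner (g x) h + c / 2 * inner h (D h) - f x - inner (g x) h
  = c / 2 * inner h (D h) by ring.
rewrite normrM ger0_norm ?divr_ge0// -mulrA ler_wpM2l ?divr_ge0//.
apply: le_trans (norm_inner_le _ _) _.
by have := ler_wpM2l (normr_ge0 h) (Dk h); rewrite expr2 mulrCA.
Qed.

Lemma quadratic_le x h :
  f (x + h) <= f x + inner (grad f x) h + c * k * `|h| ^+ 2.
Proof.
rewrite grad_quadratic f_add lerD2l.
have : inner h (D h) <= `|h| * (k * `|h|).
  by apply: le_trans (inner_le _ _) _; rewrite ler_wpM2l.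
have := pD h => h0 h1.
have := ler_wpM2l c0 h1; have := mulr_ge0 c0 h0; lra.
Qed.

End Quadratic.

End Gradient.

Lemma lipschitzE (R : realType) (E : normedModType R) (f : E -> E) (L : R) :
  L.-lipschitz f -> forall x y, `|f x - f y| <= L * `|x - y|.
Proof. by move=> fL x y; exact: (fL (x, y)). Qed.

(** * One step of the scheme *)

Lemma sqr_sum4_le (R : realFieldType) (w x y z t : R) :
  0 <= w -> w <= x + y + z + t ->
  w ^+ 2 <= 4 * (x ^+ 2 + y ^+ 2 + z ^+ 2 + t ^+ 2).
Proof.
move=> w0 wx; apply: (@le_trans _ _ ((x + y + z + t) ^+ 2)).
  by rewrite ler_pXn2r// nnegrE// (le_trans w0 wx).
have := sqr_ge0 (x - y); have := sqr_ge0 (x - z); have := sqr_ge0 (x - t).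
have := sqr_ge0 (y - z); have := sqr_ge0 (y - t); have := sqr_ge0 (z - t).
lra.
Qed.

(* In the energy balance, q is the friction <V, Psi V>, d the damping
   c2 |B^* T^(-1/2) V|^2, and u, p, f, v, w are the norms of c2 B B^* V, Psi V,
   T (grad), V and the new velocity. *)
Lemma energy_balance (R : realFieldType) (t q d u p f v w M Lam k1 k2 : R) :
  0 < t -> t <= 1 -> 0 <= q -> 0 <= d -> 0 <= M -> 0 <= Lam -> 0 <= k1 ->
  0 <= k2 -> 0 <= w ->
  u ^+ 2 <= 1 / 66 * d -> p ^+ 2 <= M * q -> v ^+ 2 <= k1 * q + k2 * d ->
  w <= v + u + t * p + t * f ->
  t * (3 * M + 16 * Lam * (k1 + M)) <= 1 / 2 -> t * (16 * Lam * (k2 + 1)) <= 1 / 10 ->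
  - d / 2 - t * (q - p * u) + t ^+ 2 / 2 * p ^+ 2 - t ^+ 2 / 2 * f ^+ 2
    + 4 * Lam * t ^+ 2 * w ^+ 2 + 3 * t * (u * f + t * p * f - t * f ^+ 2)
  <= - (t / 2 * q) - d / 4 - t ^+ 2 / 2 * f ^+ 2.
Proof.
move=> t0 t1 q0 d0 M0 L0 k10 k20 w0 ud pq vq wv h1 h2.
have t20 : 0 <= t ^+ 2 := sqr_ge0 t.
have tt : t ^+ 2 <= t by rewrite expr2 ler_piMl// ltW.
have t21 : t ^+ 2 <= 1 by apply: le_trans tt t1.
have Mq : 0 <= M * q by rewrite mulr_ge0.
have w2 : w ^+ 2 <= 4 * ((k1 + M) * q + (k2 + 1) * d + t ^+ 2 * f ^+ 2).
  apply: le_trans (sqr_sum4_le w0 wv) _; rewrite ler_pM2l// !exprMn.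
  have : t ^+ 2 * p ^+ 2 <= 1 * (M * q) by apply: ler_pM; rewrite ?sqr_ge0.
  lra.
have Lw : 4 * Lam * t ^+ 2 * w ^+ 2 <=
    4 * Lam * t ^+ 2 * (4 * ((k1 + M) * q + (k2 + 1) * d + t ^+ 2 * f ^+ 2)).
  by rewrite ler_wpM2l// mulr_ge0// mulr_ge0.
have B1 : t * q * (t * (3 * M + 16 * Lam * (k1 + M))) <= t * q * (1 / 2).
  by rewrite ler_wpM2l// mulr_ge0// ltW.
have Lk : 0 <= 16 * Lam * (k2 + 1) by rewrite !mulr_ge0// addr_ge0.
have B2 : t ^+ 2 * (16 * Lam * (k2 + 1)) <= 1 / 10.
  by apply: le_trans h2; rewrite ler_wpM2r.
have B3 : d * (t ^+ 2 * (16 * Lam * (k2 + 1))) <= d * (1 / 10) by rewrite ler_wpM2l.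
have B4 : t ^+ 2 * (16 * Lam) <= 1 / 10.
  apply: le_trans B2; rewrite ler_wpM2l// ler_peMr ?mulr_ge0//; lra.
have B5 : t ^+ 2 * f ^+ 2 * (t ^+ 2 * (16 * Lam)) <= t ^+ 2 * f ^+ 2 * (1 / 10).
  by rewrite ler_wpM2l// mulr_ge0 ?sqr_ge0.
have B6 : t ^+ 2 * p ^+ 2 <= t ^+ 2 * (M * q) by rewrite ler_wpM2l.
(* These squares give [3 t u f <= t^2 f^2 + 9/4 u^2], [3 t^2 p f <= t^2 f^2 + 9/4 t^2 p^2] and
   [t p u <= u^2 + t^2 p^2 / 4]. With the term [t^2 p^2 / 2] already present they leave
   [3 t^2 p^2 <= 3 t^2 M q] and [13/4 u^2 <= 13/264 d]. *)
have := sqr_ge0 (t * f - 3 / 2 * u); have := sqr_ge0 (t * f - 3 / 2 * t * p).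
have := sqr_ge0 (u - t * p / 2).
have := sqr_ge0 (t * f); have := sqr_ge0 (t * p).
lra.
Qed.

(** With [Y = V - t p - t g], completing the square turns the left side into [<Y + t g, T (Y + t g)>
    / 2 - t^2 <g, T g> / 2], where [Y + t g = V - t p]. The term [t <g, T Y>] is the first-order
    change of the potential. *)
Lemma kinetic_expansion (R : realType) (E : hilbertType R) (T : E -> E)
    (t : R) (V p g : E) : linear T -> self_adjoint T ->
  2^-1 * inner (T (V - t *: p - t *: g)) (V - t *: p - t *: g)
    + t * inner g (T (V - t *: p - t *: g)) =
  2^-1 * inner V (T V) - t * inner p (T V) + t ^+ 2 / 2 * inner p (T p)
    - t ^+ 2 / 2 * inner g (T g).
Proof.
move=> lT sT; rewrite !(lin_B lT) !(lin_Z lT) !innerE !sT.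
rewrite (innerC V (T p)) (innerC V (T g)) (innerC p (T g)) !sT; lra.
Qed.

Section Step.
Context (R : realType) (E : hilbertType R) (A : E -> E) (a r : R).
Hypothesis HA : small_damping A a r.

Let T (x : E) := x - r *: A x.
Let Ti := opinv T.

Variables (Phi : E -> R) (G : E -> E) (t : R).
Hypothesis t0 : 0 < t.

Let H X V := 2^-1 * inner V (Ti V) + Phi X + 3 * t * inner V (T (G X)).

(** [T^-1 >= 1] and [|T| <= 1] reduce this to [|V|^2 / 2 - 3 t |V| |G| >= - 9/2 t^2 |G|^2]. *)
Lemma energy_ge X V : Phi X - 9 / 2 * t ^+ 2 * `|G X| ^+ 2 <= H X V.
Proof.
have h1 : `|V| ^+ 2 <= inner V (Ti V) by exact: (opinv_resolvent_ge HA).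
have h2 := inner_ge V (T (G X)).
have : `|V| * `|T (G X)| <= `|V| * `|G X| by rewrite ler_wpM2l// (norm_resolvent_le HA).
move=> h3; have : - (`|V| * `|G X|) <= inner V (T (G X)) by lra.
move=> /(ler_wpM2l (ltW t0)).
have := sqr_ge0 (`|V| - 3 * t * `|G X|); rewrite /H; lra.
Qed.

Variables (P : E -> E) (M Lam k1 k2 : R).
Hypotheses (lP : linear P) (pP : psd P).
Hypotheses (M0 : 0 <= M) (PM : forall x, `|P x| ^+ 2 <= M * inner x (P x)).
Hypotheses (Lam0 : 0 <= Lam).
Hypothesis Phi_le : forall X h,
  Phi (X + h) <= Phi X + inner (G X) h + Lam * `|h| ^+ 2.
Hypothesis G_lip : forall X Y, `|G X - G Y| <= Lam * `|X - Y|.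

Lemma energy_step X V V' : 0 <= k1 -> 0 <= k2 ->
  `|V| ^+ 2 <= k1 * inner V (P V) + k2 * (r * inner V (A (Ti V))) ->
  t <= 1 ->
  t * (3 * M + 16 * Lam * (k1 + M)) <= 1 / 2 -> t * (16 * Lam * (k2 + 1)) <= 1 / 10 ->
  V' = T (V - t *: P V - t *: G X) ->
  H (X + t *: V') V' <= H X V - t / 2 * inner V (P V)
    - r / 4 * inner V (A (Ti V)) - t ^+ 2 / 2 * `|T (G X)| ^+ 2.
Proof.
move=> k10 k20 Vk t1 h1 h2 V'T; rewrite /H.
have [TiK _] := resolventK HA; have r0 : 0 < r := damping_gt0 HA.
have lT : linear T by exact: (resolvent_linear HA).
have sT : self_adjoint T by exact: (resolvent_sa HA).
set p := P V; set g := G X; set g' := G (X + t *: V').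
set q := inner V p; set dV := inner V (A (Ti V)).
have d0 : 0 <= dV by exact: (A_opinv_psd HA).
have rd0 : 0 <= r * dV by rewrite mulr_ge0// ltW.
have V'E : V' = T V - t *: T p - t *: T g by rewrite V'T !(lin_B lT) !(lin_Z lT).
have kin : 2^-1 * inner V' (Ti V') + t * inner g V' =
   2^-1 * inner V (T V) - t * inner p (T V) + t ^+ 2 / 2 * inner p (T p)
    - t ^+ 2 / 2 * inner g (T g).
  rewrite -kinetic_expansion//; have -> : Ti V' = V - t *: p - t *: g.
    by rewrite V'T; exact: TiK.
  by rewrite (innerC V') V'T (innerC (T _)).
have e1 : inner V (T V) - inner V (Ti V) <= - (r * dV) by exact: (kinetic_le HA).
have e2 : q - `|p| * (r * `|A V|) <= inner p (T V).
  rewrite /T innerDr innerNr innerZr (innerC p V).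
  have := ler_wpM2l (ltW r0) (inner_le p (A V)); rewrite -/q; lra.
have e3 : inner p (T p) <= `|p| ^+ 2.
  by apply: le_trans (inner_le _ _) _; rewrite expr2 ler_wpM2l// (norm_resolvent_le HA).
have e4 : `|T g| ^+ 2 <= inner g (T g) by exact: (resolvent_sqr_le HA).
have pot := Phi_le X (t *: V').
have e5 : `|g' - g| <= Lam * (t * `|V'|).
  apply: le_trans (G_lip _ _) _.
  by rewrite addrC addKr normrZ gtr0_norm.
(* Multiplied by [3 t] this gives [3 Lam t^2 |V'|^2]; the remainder in [pot] adds one more, hence
   the [4 * Lam] in [energy_balance]. *)
have e6 : inner V' (T g') - inner V' (T g) <= `|V'| * (Lam * (t * `|V'|)).
  rewrite -innerNr -innerDr -(lin_B lT); apply: le_trans (inner_le _ _) _.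
  by rewrite ler_wpM2l// (le_trans _ e5)// (norm_resolvent_le HA).
(* Inserting [V'] into the cross term produces [- t |T g|^2], the descent for which that term was
   added to the energy. *)
have e7 : inner V' (T g) - inner V (T g) <=
    r * `|A V| * `|T g| + t * `|p| * `|T g| - t * `|T g| ^+ 2.
  have Tp : `|T p| <= `|p| := norm_resolvent_le HA p.
  rewrite V'E [T V]/T; move: (T g) (T p) Tp => y z zp.
  rewrite !innerE inner_norm.
  have := ler_wpM2l (ltW r0) (inner_ge (A V) y).
  have : - (`|p| * `|y|) <= inner z y.
    by apply: le_trans (inner_ge _ _); rewrite lerN2 ler_wpM2r.
  move=> /(ler_wpM2l (ltW t0)); lra.
have Vn : `|V'| <= `|V| + r * `|A V| + t * `|p| + t * `|T g|.
  rewrite V'E; apply: le_trans (ler_normB _ _) _; rewrite normrZ gtr0_norm// lerD2r.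
  apply: le_trans (ler_normB _ _) _; rewrite normrZ gtr0_norm//; apply: lerD.
    by apply: le_trans (ler_normB _ _) _; rewrite normrZ gtr0_norm.
  by rewrite ler_wpM2l ?(ltW t0)// (norm_resolvent_le HA).
have u2 : (r * `|A V|) ^+ 2 <= 1 / 66 * (r * dV).
  by rewrite exprMn expr2 -mulrA; exact: (A_sqr_norm_le HA).
have := energy_balance t0 t1 (pP V) rd0 M0 Lam0 k10 k20 (normr_ge0 V') u2 (PM V) Vk Vn h1 h2.
rewrite -/p -/q.
move: pot; rewrite innerZr normrZ gtr0_norm// exprMn -/g -/g'.
have t20 : 0 <= t ^+ 2 / 2 by rewrite divr_ge0// sqr_ge0.
have := ler_wpM2l (ltW t0) e2; have := ler_wpM2l t20 e3; have := ler_wpM2l t20 e4.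
have := ler_wpM2l (ltW t0) e6; have := ler_wpM2l (ltW t0) e7.
lra.
Qed.

End Step.

(** * Energy decay for the discretized system *)

Lemma norm_sqrD_le (R : realType) (E : normedModType R) (x y : E) :
  `|x + y| ^+ 2 <= 2 * `|x| ^+ 2 + 2 * `|y| ^+ 2.
Proof.
have h := ler_normD x y; have : `|x + y| ^+ 2 <= (`|x| + `|y|) ^+ 2.
  by rewrite ler_pXn2r// nnegrE ?addr_ge0.
have := sqr_ge0 (`|x| - `|y|); lra.
Qed.

Lemma sum_increment_le (R : realFieldType) (v v' i w w' j s t u : R) :
  v' <= v + i + s -> t <= u -> w' <= w + j + t ->
  v' + w' <= v + w + (i + j) + (s + u).
Proof. lra. Qed.

(** Used with [t = dt^2], [s = c3], [g = |g0|^2] and squared gradient norms [gv], [gq], [q]. The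
    condition on [C] absorbs [9 t gv] into [1 + v - vmin]; the one on [cbar] makes the quadratic
    part of [9 t gq] cost at most [s d / 4], half of [s d / 2]. *)
Lemma potential_lower_bound (R : realFieldType)
    (v vmin q i d g gv gq y s t C cbar : R) :
  0 <= t -> 0 <= s -> 0 <= 1 + v - vmin -> 0 <= s * d ->
  9 * t * C <= 1 -> 72 * t * cbar <= 1 ->
  gv <= C * (1 + v - vmin) -> q <= 2 * gv + 2 * gq ->
  gq <= 2 * (s ^+ 2 * y) + 2 * g -> s ^+ 2 * y <= cbar * (s * d) ->
  vmin - 1 + s / 4 * d - i - 18 * t * g <=
    v + (s / 2 * d - i) - 9 / 2 * t * q.
Proof.
move=> t0 s0 v0 sd0 tC tc /(ler_wpM2l t0) h1 /(ler_wpM2l t0) h2.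
move=> /(ler_wpM2l t0) h3 /(ler_wpM2l t0) h4.
have := ler_wpM2r v0 tC; have := ler_wpM2r sd0 tc; lra.
Qed.

Lemma scaled_sqr_le (R : realFieldType) (s d x u v : R) :
  0 <= s * d -> x <= u * d -> s * u <= v -> s ^+ 2 * x <= v * (s * d).
Proof.
move=> sd0 /(ler_wpM2l (sqr_ge0 s)) h1 /(ler_wpM2r sd0); lra.
Qed.

Lemma affine_difference (Z : zmodType) (p q x y g : Z) :
  (p + (x - g)) - (q + (y - g)) = (p - q) + (x - y).
Proof. by rewrite opprD addrACA opprB subrKA. Qed.

(** * The operator [B B^*] and the step-size condition *)

Section BBsFacts.
Context (R : realType) (E U : hilbertType R) (B : {linear U -> E}).
Hypothesis B_cont : continuous B.

Lemma linear_fun : linear (B : U -> E).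
Proof. by move=> a x y; rewrite linearP. Qed.

Lemma inner_BBs x : inner x (BBs B x) = `|adjoint B x| ^+ 2.
Proof.
have [k _ Bk] := lin_continuous_bounded linear_fun B_cont.
by rewrite innerC (adjointP linear_fun Bk) inner_norm.
Qed.

Lemma BBs_linear : linear (BBs B).
Proof.
have [k _ Bk] := lin_continuous_bounded linear_fun B_cont.
by move=> a x y; rewrite /BBs /= (adjoint_linear linear_fun Bk) linearP.
Qed.

Lemma BBs_sa : self_adjoint (BBs B).
Proof.
have [k _ Bk] := lin_continuous_bounded linear_fun B_cont.
move=> x y; rewrite /BBs /= (adjointP linear_fun Bk).
by rewrite [RHS]innerC (adjointP linear_fun Bk) innerC.
Qed.

Lemma BBs_bounded : exists k, forall x, `|BBs B x| <= k * `|x|.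
Proof.
have [k k0 Bk] := lin_continuous_bounded linear_fun B_cont.
exists (k * k) => x; apply: le_trans (Bk _) _; rewrite -mulrA ler_wpM2l//.
exact: (adjoint_bound linear_fun Bk).
Qed.

(** [c3 dt rho 1] is [rho dt^3], the common factor of [c2] and [c3]. The bounds on [rho] become
    two-sided bounds on [c2] times the norm of [B B^*]; the last estimate then follows from
    [c <= cbar]. *)
Lemma step_conditionP (dt rho c cbar gamma h : R) :
  0 <= c <= cbar -> 0 < gamma -> step_condition B dt rho c (1 / 66) gamma h ->
  [/\ small_damping (BBs B) (opnorm (BBs B)) (c2 dt rho c),
      1 <= 66 * opnorm (BBs B) / gamma * c2 dt rho c,
      0 < dt <= h,
      c * c3 dt rho 1 = c3 dt rho c /\ 0 < c3 dt rho 1 &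
      c3 dt rho c * (2 * opnorm (BBs B)) <= cbar].
Proof.
move=> /andP[c0 cb] g0 [rho0 rl ru /andP[dt0 dth]].
set a := opnorm (BBs B) in rl ru *.
have [k Ak] := BBs_bounded.
have a0 : 0 <= a := opnorm_ge0 BBs_linear Ak.
have Aa x : `|BBs B x| <= a * `|x| := opnorm_ge BBs_linear x Ak.
have s0 : 0 < 1 + c * dt ^+ 2 by rewrite ltr_wpDr// mulr_ge0// sqr_ge0.
(* A zero norm would make the upper quotient 0, contrary to [0 < rho]. *)
have an0 : a != 0.
  by apply: contraTneq ru => ->; rewrite mulr0 invr0 mulr0 -ltNge.
have a_gt0 : 0 < a by rewrite lt_def an0.
have d0 : 0 < dt ^+ 3 * (1 + c * dt ^+ 2) * a by rewrite !mulr_gt0// exprn_gt0.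
move: rl ru; rewrite ler_pdivrMr// ler_pdivlMr// => rl ru.
have c2E : c2 dt rho c * a = rho * (dt ^+ 3 * (1 + c * dt ^+ 2) * a).
  by rewrite /c2; ring.
have c31 : 0 < c3 dt rho 1 by rewrite /c3 mul1r mulr_gt0// exprn_gt0.
have c3E : c * c3 dt rho 1 = c3 dt rho c by rewrite /c3; ring.
have c2c3 : c2 dt rho c = c3 dt rho 1 * (1 + c * dt ^+ 2) by rewrite /c2 /c3; ring.
have ra : c2 dt rho c * a <= 1 / 66 by rewrite c2E.
split=> //.
- split=> //; first exact: BBs_linear; first exact: BBs_sa.
    by move=> x; rewrite inner_BBs sqr_ge0.
  by rewrite c2c3 mulr_gt0.
- have -> : 66 * a / gamma * c2 dt rho c = 66 * (c2 dt rho c * a) / gamma by ring.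
  by rewrite ler_pdivlMr// c2E; lra.
- by rewrite dt0 dth.
- have h1 : c3 dt rho 1 * a <= 1 / 66.
    apply: le_trans ra; rewrite ler_wpM2r// c2c3 ler_peMr ?(ltW c31)//.
    by rewrite lerDl mulr_ge0// sqr_ge0.
  rewrite -c3E -mulrA; have := ler_wpM2l c0 h1; have : 0 <= cbar by exact: le_trans cb.
  by lra.
Qed.

End BBsFacts.

(* The factor 66 a / gamma, for a = |B B^*|, bounds 1 / c2 from above. *)
Definition step_bound (R : realType) (a C L M gamma cbar k1 k2 : R) : R :=
  (1 + 6 * `|M| + 32 * (`|L| + cbar) * (k1 + `|M|)
   + 160 * (`|L| + cbar) * (k2 * (66 * a / gamma) + 1) + 9 * C + 72 * cbar)^-1.

Section EnergyDecay.
Context (R : realType) (E U : hilbertType R) (B : {linear U -> E}).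
Hypothesis B_cont : continuous B.
Let a := opnorm (BBs B).
Variables (C L M gamma cbar k1 k2 : R).
Hypotheses (C0 : 0 < C) (gamma0 : 0 < gamma) (cbar0 : 0 <= cbar).
Hypotheses (k10 : 0 <= k1) (k20 : 0 <= k2).
Let h := step_bound a C L M gamma cbar k1 k2.
(** A Lipschitz constant of the full gradient: [|L|] serves [grad V], with [L] of any sign, and
    [cbar] serves [grad Vhat] because [2 c3 a <= cbar]. *)
Let Lam := `|L| + cbar.
Let k2' := k2 * (66 * a / gamma).

Let a0 : 0 <= a.
Proof. by have [k Ak] := BBs_bounded B_cont; exact: (opnorm_ge0 (BBs_linear B_cont) Ak). Qed.

Let Lam0 : 0 <= Lam. Proof. by rewrite addr_ge0. Qed.

Let k2'0 : 0 <= k2'.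
Proof. by rewrite mulr_ge0// divr_ge0 ?(ltW gamma0)// mulr_ge0. Qed.

Let terms_ge0 : [/\ 0 <= 6 * `|M|, 0 <= 32 * Lam * (k1 + `|M|),
  0 <= 160 * Lam * (k2' + 1), 0 <= 9 * C & 0 <= 72 * cbar].
Proof.
split; rewrite ?mulr_ge0 ?(ltW C0)//; last by rewrite addr_ge0.
by rewrite addr_ge0.
Qed.

Lemma step_bound_gt0 : 0 < h.
Proof.
by rewrite invr_gt0 -/Lam -/k2'; have [? ? ? ? ?] := terms_ge0; lra.
Qed.

(** [1 / h] is a sum of nonnegative terms and [t / h <= 1]. Its weights carry extra factors 2 and
    10, which yield 1/2 and 1/10; the summand 1 gives [t <= 1], hence [t^2 <= t]. *)
Let step_boundP t : 0 < t <= h -> [/\ 0 < t <= 1,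
  t * (3 * `|M| + 16 * Lam * (k1 + `|M|)) <= 1 / 2,
  t * (16 * Lam * (k2' + 1)) <= 1 / 10, 9 * t ^+ 2 * C <= 1
  & 72 * t ^+ 2 * cbar <= 1].
Proof.
move=> /andP[t0 th].
have : t * h^-1 <= 1 by rewrite ler_pdivrMr ?mul1r// step_bound_gt0.
rewrite /h /step_bound invrK -/Lam -/k2'.
have [/(mulr_ge0 (ltW t0)) ? /(mulr_ge0 (ltW t0)) ? /(mulr_ge0 (ltW t0)) ?
  /(mulr_ge0 (ltW t0)) ? /(mulr_ge0 (ltW t0)) ?] := terms_ge0.
move=> tN; have t1 : t <= 1 by lra.
have tt : t ^+ 2 <= t by rewrite expr2 ler_piMl// ltW.
have hC : C * t ^+ 2 <= C * t by rewrite ler_wpM2l// ltW.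
have hc : cbar * t ^+ 2 <= cbar * t by rewrite ler_wpM2l.
by split; [rewrite t0 t1|..]; lra.
Qed.

Variables (V : E -> R) (Vmin : R) (Psi : E -> {linear E -> E}) (Xhat g0 : E).
Hypotheses (V_adm : admissible_potential C Vmin V) (V_lip : L.-lipschitz (grad V)).
Hypotheses (Psi_adm : admissible_friction Psi) (Psi_norm : supnorm Psi = M).
Variables (dt rho c : R).
Hypothesis c_bounds : 0 <= c <= cbar.
Hypothesis steps : step_condition B dt rho c (1 / 66) gamma h.

Let A := BBs B.
Let r := c2 dt rho c.
Let T := Top B dt rho c.
Let Ti := opinv T.
Let S := Tinvsqrt B dt rho c.
(* Part (i) is the case g0 = 0, part (ii) the case g0 = grad V Xhat. *)
Let Vhat (X : E) := Vhat_quad B dt rho c Xhat X - inner g0 (X - Xhat).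
Let H := Hcl_eps B dt rho c V Vhat (3 * dt).

Let HA : small_damping A a r.
Proof. by have [] := step_conditionP B_cont c_bounds gamma0 steps. Qed.

Let dt_bounds : 0 < dt <= h.
Proof. by have [] := step_conditionP B_cont c_bounds gamma0 steps. Qed.

Let c30 : 0 <= c3 dt rho c.
Proof.
have [_ _ _ [<- c3_gt0] _] := step_conditionP B_cont c_bounds gamma0 steps.
by rewrite mulr_ge0 ?(ltW c3_gt0)//; case/andP: c_bounds.
Qed.

Let c3a : c3 dt rho c * (2 * a) <= cbar.
Proof. by have [] := step_conditionP B_cont c_bounds gamma0 steps. Qed.

Lemma damping_norm x : inner x (A (Ti x)) = `|adjoint B (S x)| ^+ 2.
Proof. by rewrite (A_opinv_sqrt HA) -(inner_BBs B_cont). Qed.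

Let VhatE : Vhat = fun X => c3 dt rho c / 2 * inner (X - Xhat) (A (Ti (X - Xhat)))
  - inner g0 (X - Xhat).
Proof. by apply/funext => X; rewrite damping_norm. Qed.

Let grad_Vhat X : grad Vhat X = c3 dt rho c *: A (Ti (X - Xhat)) - g0.
Proof.
rewrite VhatE (grad_quadratic Xhat g0 (A_opinv_linear HA) (A_opinv_sa HA)
  (A_opinv_bound HA))//.
Qed.

Let diffV X : differentiable V X. Proof. by case: V_adm => -[]. Qed.

Let pot_le X k : V (X + k) + Vhat (X + k) <=
  V X + Vhat X + inner (grad V X + grad Vhat X) k + Lam * `|k| ^+ 2.
Proof.
have h1 : V (X + k) <= V X + inner (grad V X) k + `|L| * `|k| ^+ 2.
  apply: grad_lipschitz_le => // x y; apply: le_trans (lipschitzE V_lip x y) _.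
  by rewrite ler_wpM2r// ler_norm.
have : Vhat (X + k) <= Vhat X + inner (grad Vhat X) k
    + c3 dt rho c * (2 * a) * `|k| ^+ 2.
  rewrite VhatE; exact: (quadratic_le Xhat g0 (A_opinv_linear HA) (A_opinv_sa HA)
    (A_opinv_psd HA) (A_opinv_bound HA)).
have := ler_wpM2r (sqr_ge0 `|k|) c3a.
rewrite innerDl /Lam (mulrDl `|L|); move: h1.
exact: sum_increment_le.
Qed.

Let grad_lip X Y : `|(grad V X + grad Vhat X) - (grad V Y + grad Vhat Y)| <=
  Lam * `|X - Y|.
Proof.
have -> : (grad V X + grad Vhat X) - (grad V Y + grad Vhat Y) =
    (grad V X - grad V Y) + c3 dt rho c *: A (Ti (X - Y)).
  have -> : X - Y = (X - Xhat) - (Y - Xhat) by rewrite opprB addrA subrK.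
  have -> := lin_B (A_opinv_linear HA) (X - Xhat) (Y - Xhat).
  by rewrite !grad_Vhat scalerBr; exact: affine_difference.
apply: le_trans (ler_normD _ _) _; rewrite normrZ ger0_norm// mulrDl lerD//.
  by apply: le_trans (lipschitzE V_lip X Y) _; rewrite ler_wpM2r// ler_norm.
have := ler_wpM2l c30 (A_opinv_bound HA (X - Y)).
move=> /le_trans; apply; by rewrite mulrA ler_wpM2r.
Qed.

Let Psi_bound X x : `|Psi X x| <= `|M| * `|x|.
Proof.
have [Pc Pub _ _] := Psi_adm; have lP := linear_fun (Psi X).
have [k k0 Pk] := lin_continuous_bounded lP (Pc X).
apply: le_trans (opnorm_ge lP x Pk) _; rewrite ler_wpM2r//.
apply: le_trans (ler_norm _); rewrite -Psi_norm.
by apply: ub_le_sup => //; exists X.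
Qed.

(** The quadratic term is kept on the left because in part (ii) it has to dominate the linear term
    in [g0]. *)
Lemma energy_lower_bound X W :
  Vmin - 1 + c3 dt rho c / 4 * `|adjoint B (X - Xhat)| ^+ 2 - inner g0 (X - Xhat)
    - 18 * dt ^+ 2 * `|g0| ^+ 2 <= H X W.
Proof.
have [/andP[t0 t1] _ _ tC tc] := step_boundP dt_bounds.
apply: le_trans (_ : V X + Vhat X - 9 / 2 * dt ^+ 2 * `|grad V X + grad Vhat X| ^+ 2 <= _); last first.
  rewrite /H /Hcl_eps /Hcl -(addrA _ (V X)).
  exact: (energy_ge HA (fun X => V X + Vhat X) (fun X => grad V X + grad Vhat X)).
set Y := X - Xhat; set d := inner Y (A (Ti Y)).
have Vhat_d : Vhat X = c3 dt rho c / 2 * d - inner g0 Y by rewrite VhatE.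
have d_ge : `|adjoint B Y| ^+ 2 <= d.
  by rewrite -(inner_BBs B_cont); exact: (A_le_A_opinv HA).
have G1 := norm_sqrD_le (grad V X) (grad Vhat X).
have G2 := norm_sqrD_le (c3 dt rho c *: A (Ti Y)) (- g0).
rewrite normrN -grad_Vhat normrZ ger0_norm// exprMn in G2.
have D2 : `|A (Ti Y)| ^+ 2 <= 2 * a * d.
  apply: (@psd_sqr_norm_le _ _ (fun x => A (Ti x))).
  - exact: (A_opinv_linear HA).
  - exact: (A_opinv_sa HA).
  - exact: (A_opinv_psd HA).
  - by rewrite mulr_ge0.
  - exact: (A_opinv_bound HA).
have d0 : 0 <= d := A_opinv_psd HA Y.
have c3d0 : 0 <= c3 dt rho c * d by rewrite mulr_ge0.
have D3 : c3 dt rho c ^+ 2 * `|A (Ti Y)| ^+ 2 <= cbar * (c3 dt rho c * d).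
  exact: scaled_sqr_le D2 c3a.
have [_ Vm VC] := V_adm.
have V1 : 0 <= 1 + V X - Vmin by rewrite subr_ge0 (le_trans (Vm X))// lerDr.
have := potential_lower_bound (inner g0 Y) (sqr_ge0 dt) c30 V1 c3d0 tC tc (VC X) G1 G2 D3.
rewrite Vhat_d; apply: le_trans; rewrite !lerD2r lerD2l ler_wpM2l//.
by rewrite divr_ge0.
Qed.

Lemma energy_decay (X0 V0 : E) (Xs Vs : nat -> E) l :
  (forall X W, `|W| ^+ 2 <= k1 * inner W (Psi X W) + k2 * `|adjoint B W| ^+ 2) ->
  euler_scheme B dt rho c V Vhat Psi X0 V0 Xs Vs ->
  H (Xs l.+1) (Vs l.+1) <= H (Xs l) (Vs l)
    - dt / 2 * inner (Vs l) (Psi (Xs l) (Vs l))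
    - c2 dt rho c / 4 * `|adjoint B (S (Vs l))| ^+ 2
    - dt ^+ 2 / 2 * `|T (grad V (Xs l) + grad Vhat (Xs l))| ^+ 2.
Proof.
move=> Wk [_ _ XsE VsE].
have [/andP[t0 t1] h1 h2 _ _] := step_boundP dt_bounds.
have r_c1 : r = dt * c1 dt rho c by rewrite /r /c1 /c2; ring.
have V'E : Vs l.+1 = T (Vs l - dt *: Psi (Xs l) (Vs l)
    - dt *: (grad V (Xs l) + grad Vhat (Xs l))).
  by rewrite VsE; exact: (euler_velocity HA _ _ _ r_c1).
have [_ _ sP pP] := Psi_adm.
have [_ rk _ _ _] := step_conditionP B_cont c_bounds gamma0 steps.
have Vk : `|Vs l| ^+ 2 <= k1 * inner (Vs l) (Psi (Xs l) (Vs l))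
    + k2' * (r * inner (Vs l) (A (Ti (Vs l)))).
  (* The lower bound on [rho] enters as [1 <= 66 a / gamma * c2], which inserts the factor [r];
     [A <= A T^-1] does the rest. *)
  apply: le_trans (Wk (Xs l) (Vs l)) _; rewrite lerD2l /k2' -mulrA ler_wpM2l//.
  have := A_le_A_opinv HA (Vs l); rewrite (inner_BBs B_cont) => /le_trans; apply.
  by rewrite mulrA ler_peMl// (A_opinv_psd HA).
have PM x : `|Psi (Xs l) x| ^+ 2 <= `|M| * inner x (Psi (Xs l) x).
  apply: psd_sqr_norm_le => //; exact: linear_fun.
have := energy_step HA t0 (pP (Xs l)) (normr_ge0 M) PM Lam0 pot_le grad_lip
  k10 k2'0 Vk t1 h1 h2 V'E.
by rewrite -XsE damping_norm /H /Hcl_eps /Hcl -!(addrA _ (V _)).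
Qed.

End EnergyDecay.

(** * Coercivity and the two parts of the theorem *)

Section Conclusions.
Context (R : realType) (E U : hilbertType R) (B : {linear U -> E}).
Hypotheses (B_cont : continuous B) (B_closed_range : closed (range B)).

Lemma Vhat_quadE (dt rho c : R) (Xhat : E) : Vhat_quad B dt rho c Xhat =
  fun X => Vhat_quad B dt rho c Xhat X - inner 0 (X - Xhat).
Proof. by apply/funext => X; rewrite inner0l subr0. Qed.

(** Split [W] into [W - P] and its projection [P]. As [P] lies in [ran B], [b |P|^2 <= |B^* P|^2],
    and [B^* P = B^* W - B^* (W - P)]. The constant is chosen before [E0], so that [h] can be
    too. *)
Lemma norm_sqr_projection_le : exists k : R, 0 <= k /\
  forall (E0 : set E), closed_subspace E0 -> E0 `<=` range B -> forall W,
  `|W| ^+ 2 <= k * `|W - orth_proj E0 W| ^+ 2 + k * `|adjoint B W| ^+ 2.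
Proof.
have [b b0 hb] := adjoint_bounded_below B_cont B_closed_range.
have [k k0 Bk] := lin_continuous_bounded (linear_fun B) B_cont.
have lA := adjoint_linear (linear_fun B) Bk.
exists (2 + 4 / b * (k ^+ 2 + 1)).
have ib : 0 <= 4 / b by rewrite divr_ge0// ltW.
split; first by rewrite addr_ge0// mulr_ge0// addr_ge0// sqr_ge0.
move=> E0 cE0 E0B W; have [E0P _] := orth_projP cE0 W.
set P := orth_proj E0 W in E0P *.
have h1 := norm_sqrD_le (W - P) P; rewrite subrK in h1.
have h2 := hb _ (E0B _ E0P).
have h3 : `|adjoint B P| ^+ 2 <=
    2 * `|adjoint B W| ^+ 2 + 2 * (k ^+ 2 * `|W - P| ^+ 2).
  have -> : adjoint B P = adjoint B W + - adjoint B (W - P).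
    by rewrite (lin_B lA) opprB addrC subrK.
  apply: le_trans (norm_sqrD_le _ _) _; rewrite normrN lerD2l ler_pM2l// -exprMn.
  rewrite ler_pXn2r ?nnegrE ?mulr_ge0//.
  exact: (adjoint_bound (linear_fun B) Bk).
have h4 : `|P| ^+ 2 <= 1 / b * `|adjoint B P| ^+ 2.
  by rewrite mul1r mulrC ler_pdivlMr// mulrC.
have h5 : 1 / b * `|adjoint B P| ^+ 2 <=
    1 / b * (2 * `|adjoint B W| ^+ 2 + 2 * (k ^+ 2 * `|W - P| ^+ 2)).
  by rewrite ler_wpM2l// divr_ge0// ltW.
have w0 := sqr_ge0 `|W - P|; have a0 := sqr_ge0 `|adjoint B W|.
have := mulr_ge0 ib w0; have := mulr_ge0 ib a0.
have := mulr_ge0 (mulr_ge0 ib (sqr_ge0 k)) a0.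
lra.
Qed.

End Conclusions.

Theorem theorem5p13 (R : realType) (E U : hilbertType R) (B : {linear U -> E})
  (B_cont : continuous B) (B_closed_range : closed (range B)) :
  (exists alpha : R, [/\ 0 < alpha, alpha < 1, alpha = 1 / 66 &
    forall (C L M psi gamma cbar : R),
      0 < C -> 0 < psi -> 0 < gamma <= 1 -> 0 <= cbar ->
    exists h : R, 0 < h /\
    forall (V : E -> R) (Vmin : R) (Psi : E -> {linear E -> E}) (Xhat : E)
      (E0 : set E),
      admissible_potential C Vmin V -> L.-lipschitz (grad V) ->
      admissible_friction Psi -> supnorm Psi = M ->
      closed_subspace E0 -> E0 `<=` range B ->
      (forall W X : E, psi * `|W - orth_proj E0 W| ^+ 2 <= inner W (Psi X W)) ->
    forall dt rho c : R,
      0 <= c <= cbar -> step_condition B dt rho c alpha gamma h ->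
    let T := Top B dt rho c in
    let Vhat := Vhat_quad B dt rho c Xhat in
    let H := Hcl_eps B dt rho c V Vhat (3 * dt) in
      (exists m : R, forall X W : E, m <= H X W) /\
      forall (X0 V0 : E) (Xs Vs : nat -> E),
        euler_scheme B dt rho c V Vhat Psi X0 V0 Xs Vs ->
      forall l,
        H (Xs l.+1) (Vs l.+1) <= H (Xs l) (Vs l)
          - dt / 2 * psi * `|Vs l - orth_proj E0 (Vs l)| ^+ 2
          - c1 dt rho c * dt / 4
            * `|adjoint B (Tinvsqrt B dt rho c (Vs l))| ^+ 2
          - dt ^+ 2 / 2 * `|T (grad V (Xs l) + grad Vhat (Xs l))| ^+ 2]) /\
  (set_surj setT setT B ->
   exists alpha : R, [/\ 0 < alpha, alpha < 1, alpha = 1 / 66 &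
    exists nu : R, 0 < nu /\
    forall (C L M gradnorm gamma cbar : R),
      0 < C -> 0 < gamma <= 1 -> 0 < cbar ->
    exists h : R, 0 < h /\
    forall (V : E -> R) (Vmin : R) (Psi : E -> {linear E -> E}) (Xhat : E),
      admissible_potential C Vmin V -> L.-lipschitz (grad V) ->
      admissible_friction Psi -> supnorm Psi = M ->
      `|grad V Xhat| = gradnorm ->
    forall dt rho c : R,
      0 < c <= cbar -> step_condition B dt rho c alpha gamma h ->
    let T := Top B dt rho c in
    let Vhat := Vhat_lin B dt rho c V Xhat in
    let H := Hcl_eps B dt rho c V Vhat (3 * dt) in
      (exists m : R, forall X W : E, m <= H X W) /\
      forall (X0 V0 : E) (Xs Vs : nat -> E),
        euler_scheme B dt rho c V Vhat Psi X0 V0 Xs Vs ->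
      forall l,
        H (Xs l.+1) (Vs l.+1) <= H (Xs l) (Vs l)
          - nu * c1 dt rho c * dt * `|Vs l| ^+ 2
          - dt ^+ 2 / 2 * `|T (grad V (Xs l) + grad Vhat (Xs l))| ^+ 2]).
Proof.
split.
  have [k [k0 hk]] := norm_sqr_projection_le B_cont B_closed_range.
  exists (1 / 66); split; [lra|lra|by []|].
  move=> C L M psi gamma cbar C0 psi0 /andP[gamma0 _] cbar0.
  have kpsi0 : 0 <= k / psi by rewrite divr_ge0// ltW.
  (* The lower bound on the friction converts [k |W - P W|^2] into [k / psi <W, Psi W>], hence
     [k1 = k / psi] and [k2 = k]. *)
  exists (step_bound (opnorm (BBs B)) C L M gamma cbar (k / psi) k); split.
    exact: step_bound_gt0.
  move=> V Vmin Psi Xhat E0 Vadm Vlip Psiadm PsiM cE0 E0B E0psi dt rho c cb st T Vhat H.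
  have dt0 : 0 < dt by case: st => _ _ _ /andP[].
  have [_ _ _ [c3E c31] _] := step_conditionP B_cont cb gamma0 st.
  split.
    exists (Vmin - 1) => X W.
    have := energy_lower_bound B_cont C0 gamma0 cbar0 kpsi0 k0 Xhat 0 Vadm cb st X W.
    rewrite -Vhat_quadE inner0l normr0 expr0n mulr0 !subr0; apply: le_trans.
    rewrite lerDl mulr_ge0 ?sqr_ge0// divr_ge0// -c3E mulr_ge0 ?(ltW c31)//.
    by case/andP: cb.
  move=> X0 V0 Xs Vs sch l.
  have Wk X W : `|W| ^+ 2 <= k / psi * inner W (Psi X W) + k * `|adjoint B W| ^+ 2.
    apply: le_trans (hk _ cE0 E0B W) _; rewrite lerD2r -mulrA ler_wpM2l//.
    by rewrite mulrC ler_pdivlMr// mulrC.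
  rewrite /H /Vhat Vhat_quadE in sch *.
  apply: le_trans (energy_decay B_cont C0 gamma0 cbar0 kpsi0 k0 Vadm Vlip Psiadm
    PsiM cb st l Wk sch) _.
  have -> : c2 dt rho c = c1 dt rho c * dt by rewrite /c1 /c2; ring.
  rewrite !lerD2r lerD2l lerN2 -mulrA ler_wpM2l ?divr_ge0 ?(ltW dt0)//.
move=> Bsurj.
have [b b0 hb] := adjoint_bounded_below B_cont B_closed_range.
have {}hb W : b * `|W| ^+ 2 <= `|adjoint B W| ^+ 2.
  by apply: hb; have [x _ <-] := Bsurj W I; exists x.
exists (1 / 66); split; [lra|lra|by []|].
(* Since [c2 = c1 dt], the damping [c2 / 4 |B^* T^(-1/2) V|^2] is at least [b / 4 c1 dt |V|^2]. *)
exists (b / 4); split; first by rewrite divr_gt0.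
move=> C L M gradnorm gamma cbar C0 /andP[gamma0 _] /ltW cbar0.
have ib0 : 0 <= b^-1 by rewrite invr_ge0 ltW.
(* The adjoint alone controls the norm here, so [k1 = 0] and [k2 = 1 / b]. *)
exists (step_bound (opnorm (BBs B)) C L M gamma cbar 0 b^-1); split.
  exact: step_bound_gt0.
move=> V Vmin Psi Xhat Vadm Vlip Psiadm PsiM _ dt rho c /andP[c0 cb'] st T Vhat H.
have cb : 0 <= c <= cbar by rewrite ltW.
have dt0 : 0 < dt by case: st => _ _ _ /andP[].
have [HA _ _ [c3E c31] _] := step_conditionP B_cont cb gamma0 st.
have c30 : 0 < c3 dt rho c by rewrite -c3E mulr_gt0.
split.
  set g := grad V Xhat.
  (* For [Y = X - Xhat], [c3 b / 4 |Y|^2 - |g| |Y|] is at least [- |g|^2 / (c3 b)] by completing the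
     square; [c3 > 0] because [0 < c]. *)
  exists (Vmin - 1 - `|g| ^+ 2 / (c3 dt rho c * b) - 18 * dt ^+ 2 * `|g| ^+ 2) => X W.
  have := energy_lower_bound B_cont C0 gamma0 cbar0 (lexx 0) ib0 Xhat g Vadm cb st X W.
  apply: le_trans; rewrite lerD2r -(addrA (Vmin - 1)) lerD2l.
  set Y := X - Xhat; set k := c3 dt rho c.
  have k0 : 0 < k * b by rewrite mulr_gt0.
  have h1 := ler_wpM2l (ltW c30) (hb Y).
  have h2 := inner_le g Y.
  suff : `|g| * `|Y| <= k * b / 4 * `|Y| ^+ 2 + `|g| ^+ 2 / (k * b).
    by move: h1; rewrite -/k; lra.
  have -> : k * b / 4 * `|Y| ^+ 2 + `|g| ^+ 2 / (k * b) =
      `|g| * `|Y| + (`|g| - k * b / 2 * `|Y|) ^+ 2 / (k * b).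
    by field; rewrite !gt_eqF.
  by rewrite lerDl divr_ge0 ?sqr_ge0// ltW.
move=> X0 V0 Xs Vs sch l.
have Wk X W : `|W| ^+ 2 <= 0 * inner W (Psi X W) + b^-1 * `|adjoint B W| ^+ 2.
  by rewrite mul0r add0r mulrC ler_pdivlMr// mulrC.
apply: le_trans (energy_decay B_cont C0 gamma0 cbar0 (lexx 0) ib0 Vadm Vlip
  Psiadm PsiM cb st l Wk sch) _.
have [_ _ _ pP] := Psiadm.
have h1 : b * `|Vs l| ^+ 2 <= `|adjoint B (Tinvsqrt B dt rho c (Vs l))| ^+ 2.
  apply: le_trans (hb _) _; rewrite -(inner_BBs B_cont).
  rewrite -(damping_norm B_cont gamma0 cb st).
  exact: (A_le_A_opinv HA).
have c20 : 0 <= c2 dt rho c / 4 by rewrite divr_ge0// (ltW (damping_gt0 HA)).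
have -> : b / 4 * c1 dt rho c * dt * `|Vs l| ^+ 2 =
    c2 dt rho c / 4 * (b * `|Vs l| ^+ 2) by rewrite /c1 /c2; ring.
rewrite lerD2r; apply: lerB; last exact: ler_wpM2l.
rewrite /H /Vhat /Vhat_lin gerBl; apply: mulr_ge0; [by rewrite divr_ge0 ?(ltW dt0)|exact: pP].
Qed.
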